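(* If $\mathcal C$ and $\mathcal D$ are separable fusion categories and $F\colon\mathcal C\to\mathcal D$ is a tensor functor, then $F$ is $\otimes$-Frobenius.
   Context: Work over an algebraically closed field $\Bbbk$ of arbitrary characteristic. A finite tensor category is a finite $\Bbbk$-linear abelian rigid monoidal category with bilinear tensor product and $\mathrm{End}(\mathbb 1)\cong\Bbbk$. A fusion category is a semisimple finite tensor category. It is separable if its global dimension $\sum_X|X|^2$ (sum over isomorphism classes of simple objects $X$, where $|X|^2=\mathrm{Tr}(a)\,\mathrm{Tr}((a^{-1})^{\vee})$ for any isomorphism $a\colon X\to X^{\vee\vee}$) is nonzero in $\Bbbk$. A tensor functor is an exact $\Bbbk$-linear strong monoidal functor. Let ${}_F\mathcal D_F$ be $\mathcal D$ viewed as a $\mathcal C$-bimodule category via $c\triangleright d\triangleleft c'=F(c)\otimes d\otimes F(c')$; the left and right adjoints $F^{\mathrm{la}},F^{\mathrm{ra}}\colon{}_F\mathcal D_F\to\mathcal C$ of the bimodule functor $F\colon\mathcal C\to{}_F\mathcal D_F$ canonically are $\mathcal C$-bimodule functors. $F$ is $\otimes$-Frobenius if $F^{\mathrm{la}}\cong F^{\mathrm{ra}}$ as $\mathcal C$-bimodule functors. *)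

(* Defs.v *)
From mathcomp Require Import all_boot all_order all_algebra.
Set Implicit Arguments. Unset Strict Implicit. Unset Printing Implicit Defensive.
Import GRing.Theory.
Local Open Scope ring_scope.

Declare Scope cat_scope.
Delimit Scope cat_scope with cat.
Local Open Scope cat_scope.

Record lincat (k : fieldType) := LinCat {
  obj :> Type;
  hom : obj -> obj -> vectType k;
  idm : forall X, hom X X;
  mcomp : forall X Y Z, hom Y Z -> hom X Y -> hom X Z;
  compA : forall X Y Z W (h : hom Z W) (g : hom Y Z) (f : hom X Y),
    mcomp h (mcomp g f) = mcomp (mcomp h g) f;
  comp1m : forall X Y (f : hom X Y), mcomp (idm Y) f = f;
  compm1 : forall X Y (f : hom X Y), mcomp f (idm X) = f;
  comp_linl : forall X Y Z (f : hom X Y), linear (fun g : hom Y Z => mcomp g f);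
  comp_linr : forall X Y Z (g : hom Y Z), linear (fun f : hom X Y => mcomp g f)
}.
Arguments hom {k l} X Y.
Arguments idm {k l} X.
Arguments mcomp {k l X Y Z} g f.

Notation "g ∘ f" := (mcomp g f) (at level 40, left associativity) : cat_scope.

Record iso (k : fieldType) (A : lincat k) (X Y : A) := Iso {
  fwd : hom X Y;
  bwd : hom Y X;
  fwdK : bwd ∘ fwd = idm X;
  bwdK : fwd ∘ bwd = idm Y
}.

Definition isomorphic (k : fieldType) (A : lincat k) (X Y : A) : Prop :=
  inhabited (iso X Y).

Definition is_iso (k : fieldType) (A : lincat k) (X Y : A) (f : hom X Y) : Prop :=
  exists g : hom Y X, g ∘ f = idm X /\ f ∘ g = idm Y.

Definition iso_id (k : fieldType) (A : lincat k) (X : A) : iso X X :=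
  Iso (comp1m (idm X)) (comp1m (idm X)).

Definition iso_sym (k : fieldType) (A : lincat k) (X Y : A) (f : iso X Y) :
  iso Y X := Iso (bwdK f) (fwdK f).

Lemma iso_compK (k : fieldType) (A : lincat k) (X Y Z : A)
    (g : iso Y Z) (f : iso X Y) :
  (bwd f ∘ bwd g) ∘ (fwd g ∘ fwd f) = idm X.
Proof. by rewrite compA -(compA (bwd f)) fwdK compm1 fwdK. Qed.

Definition iso_comp (k : fieldType) (A : lincat k) (X Y Z : A)
    (g : iso Y Z) (f : iso X Y) : iso X Z :=
  Iso (iso_compK g f) (iso_compK (iso_sym f) (iso_sym g)).

Definition mono (k : fieldType) (A : lincat k) (X Y : A) (f : hom X Y) : Prop :=
  forall (T : A) (g h : hom T X), f ∘ g = f ∘ h -> g = h.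

Definition epi (k : fieldType) (A : lincat k) (X Y : A) (f : hom X Y) : Prop :=
  forall (T : A) (g h : hom Y T), g ∘ f = h ∘ f -> g = h.

Definition is_zero (k : fieldType) (A : lincat k) (X : A) : Prop := idm X = 0.

Definition is_kernel (k : fieldType) (A : lincat k) (K X Y : A)
    (i : hom K X) (f : hom X Y) : Prop :=
  f ∘ i = 0 /\
  forall (T : A) (g : hom T X), f ∘ g = 0 -> exists! h : hom T K, i ∘ h = g.

Definition is_cokernel (k : fieldType) (A : lincat k) (X Y Q : A)
    (p : hom Y Q) (f : hom X Y) : Prop :=
  p ∘ f = 0 /\
  forall (T : A) (g : hom Y T), g ∘ f = 0 -> exists! h : hom Q T, h ∘ p = g.

(* [X] is the direct sum of the finite family [S], with injections [i] and
   projections [p]. *)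
Definition is_direct_sum (k : fieldType) (A : lincat k) (n : nat)
    (S : 'I_n -> A) (X : A)
    (i : forall j, hom (S j) X) (p : forall j, hom X (S j)) : Prop :=
  [/\ forall j, p j ∘ i j = idm (S j),
      forall j l, j != l -> p l ∘ i j = 0 &
      \sum_(j < n) i j ∘ p j = idm X].

Record abelian (k : fieldType) (A : lincat k) : Prop := Abelian {
  ab_zero : exists Z : A, is_zero Z;
  ab_biprod : forall X Y : A, exists (S : A) (iX : hom X S) (iY : hom Y S)
      (pX : hom S X) (pY : hom S Y),
    [/\ pX ∘ iX = idm X, pY ∘ iY = idm Y, pY ∘ iX = 0, pX ∘ iY = 0 &
        iX ∘ pX + iY ∘ pY = idm S];
  ab_kernel : forall (X Y : A) (f : hom X Y),
    exists (K : A) (i : hom K X), is_kernel i f;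
  ab_cokernel : forall (X Y : A) (f : hom X Y),
    exists (Q : A) (p : hom Y Q), is_cokernel p f;
  ab_mono : forall (X Y : A) (f : hom X Y), mono f ->
    exists (Z : A) (g : hom Y Z), is_kernel f g;
  ab_epi : forall (X Y : A) (f : hom X Y), epi f ->
    exists (Z : A) (g : hom Z X), is_cokernel f g
}.

Definition short_exact (k : fieldType) (A : lincat k) (X Y Z : A)
    (f : hom X Y) (g : hom Y Z) : Prop := is_kernel f g /\ is_cokernel g f.

Definition simple (k : fieldType) (A : lincat k) (X : A) : Prop :=
  ~ is_zero X /\
  forall (Y : A) (f : hom Y X), mono f -> is_zero Y \/ is_iso f.

Definition projective (k : fieldType) (A : lincat k) (P : A) : Prop :=
  forall (X Y : A) (p : hom X Y) (f : hom P Y), epi p ->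
  exists g : hom P X, p ∘ g = f.

Inductive finite_length (k : fieldType) (A : lincat k) : A -> Prop :=
| FiniteLength0 (X : A) : is_zero X -> finite_length X
| FiniteLengthS (X Y S : A) (f : hom X Y) (g : hom Y S) :
    short_exact f g -> simple S -> finite_length X -> finite_length Y.

(* Finite-dimensionality of the morphism spaces is part of [lincat]. *)
Record finite_abelian (k : fieldType) (A : lincat k) : Prop := FiniteAbelian {
  fin_abelian : abelian A;
  fin_length : forall X : A, finite_length X;
  fin_proj : forall X : A, exists (P : A) (p : hom P X), projective P /\ epi p;
  fin_simple : exists (n : nat) (S : 'I_n -> A),
    forall X : A, simple X -> exists j, isomorphic X (S j)
}.

Definition semisimple (k : fieldType) (A : lincat k) : Prop :=
  forall X : A, exists (n : nat) (S : 'I_n -> A)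
    (i : forall j, hom (S j) X) (p : forall j, hom X (S j)),
    (forall j, simple (S j)) /\ is_direct_sum i p.

Record linfunctor (k : fieldType) (A B : lincat k) := LinFunctor {
  fobj :> A -> B;
  fmap : forall X Y : A, hom X Y -> hom (fobj X) (fobj Y);
  fmap1 : forall X, fmap (idm X) = idm (fobj X);
  fmapM : forall X Y Z (g : hom Y Z) (f : hom X Y),
    fmap (g ∘ f) = fmap g ∘ fmap f;
  fmap_lin : forall X Y, linear (@fmap X Y)
}.
Arguments fmap {k A B} l {X Y} f.

Definition exact_functor (k : fieldType) (A B : lincat k) (F : linfunctor A B) : Prop :=
  forall (X Y Z : A) (f : hom X Y) (g : hom Y Z),
    short_exact f g -> short_exact (fmap F f) (fmap F g).

Definition idfunctor (k : fieldType) (A : lincat k) : linfunctor A A :=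
  @LinFunctor k A A id (fun _ _ f => f) (fun _ => erefl) (fun _ _ _ _ _ => erefl)
    (fun _ _ _ _ _ => erefl).

Section CompFunctor.
Context (k : fieldType) (A B E : lincat k) (G : linfunctor B E) (F : linfunctor A B).

Lemma compfunctor1 (X : A) : fmap G (fmap F (idm X)) = idm (G (F X)).
Proof. by rewrite !fmap1. Qed.

Lemma compfunctorM (X Y Z : A) (g : hom Y Z) (f : hom X Y) :
  fmap G (fmap F (g ∘ f)) = fmap G (fmap F g) ∘ fmap G (fmap F f).
Proof. by rewrite !fmapM. Qed.

Lemma compfunctor_lin (X Y : A) :
  linear (fun f : hom X Y => fmap G (fmap F f)).
Proof. by move=> a f g; rewrite !fmap_lin. Qed.

Definition compfunctor : linfunctor A E :=
  @LinFunctor k A E (fun X => G (F X)) (fun _ _ f => fmap G (fmap F f))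
    compfunctor1 compfunctorM compfunctor_lin.

End CompFunctor.

Definition iso_fmap (k : fieldType) (A B : lincat k) (F : linfunctor A B)
    (X Y : A) (f : iso X Y) : iso (F X) (F Y).
Proof.
by exists (fmap F (fwd f)) (fmap F (bwd f)); rewrite -fmapM ?fwdK ?bwdK fmap1.
Defined.

Record bifunctor (k : fieldType) (A B E : lincat k) := Bifunctor {
  bobj :> A -> B -> E;
  bmap : forall (X X' : A) (Y Y' : B),
    hom X X' -> hom Y Y' -> hom (bobj X Y) (bobj X' Y');
  bmap1 : forall X Y, bmap (idm X) (idm Y) = idm (bobj X Y);
  bmapM : forall X X' X'' Y Y' Y'' (f' : hom X' X'') (f : hom X X')
      (g' : hom Y' Y'') (g : hom Y Y'),
    bmap (f' ∘ f) (g' ∘ g) = bmap f' g' ∘ bmap f g;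
  bmap_linl : forall X X' Y Y' (g : hom Y Y'),
    linear (fun f : hom X X' => bmap f g);
  bmap_linr : forall X X' Y Y' (f : hom X X'),
    linear (fun g : hom Y Y' => bmap f g)
}.
Arguments bmap {k A B E} b {X X' Y Y'} f g.

Definition iso_bmap (k : fieldType) (A B E : lincat k) (T : bifunctor A B E)
    (X X' : A) (Y Y' : B) (f : iso X X') (g : iso Y Y') : iso (T X Y) (T X' Y').
Proof.
by exists (bmap T (fwd f) (fwd g)) (bmap T (bwd f) (bwd g));
   rewrite -bmapM ?fwdK ?bwdK bmap1.
Defined.

Lemma bmapMl (k : fieldType) (A B E : lincat k) (T : bifunctor A B E)
    (X X' X'' : A) (Y : B) (f' : hom X' X'') (f : hom X X') :
  bmap T (f' ∘ f) (idm Y) = bmap T f' (idm Y) ∘ bmap T f (idm Y).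
Proof. by rewrite -bmapM comp1m. Qed.

Lemma bmapMr (k : fieldType) (A B E : lincat k) (T : bifunctor A B E)
    (X : A) (Y Y' Y'' : B) (f' : hom Y' Y'') (f : hom Y Y') :
  bmap T (idm X) (f' ∘ f) = bmap T (idm X) f' ∘ bmap T (idm X) f.
Proof. by rewrite -bmapM comp1m. Qed.

Definition bifunctor_comp (k : fieldType) (A B E A' B' : lincat k)
    (T : bifunctor A B E) (F : linfunctor A' A) (G : linfunctor B' B) :
  bifunctor A' B' E.
Proof.
exists (fun X Y => T (F X) (G Y)) (fun _ _ _ _ f g => bmap T (fmap F f) (fmap G g)).
- by move=> X Y; rewrite !fmap1 bmap1.
- by move=> *; rewrite !fmapM bmapM.
- by move=> X X' Y Y' g a f f'; rewrite fmap_lin bmap_linl.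
- by move=> X X' Y Y' f a g g'; rewrite fmap_lin bmap_linr.
Defined.

Record moncat (k : fieldType) := MonCat {
  mcat :> lincat k;
  tens : bifunctor mcat mcat mcat;
  munit : mcat;
  assoc : forall X Y Z, iso (tens (tens X Y) Z) (tens X (tens Y Z));
  lunit : forall X, iso (tens munit X) X;
  runit : forall X, iso (tens X munit) X;
  assoc_nat : forall X X' Y Y' Z Z' (f : hom X X') (g : hom Y Y') (h : hom Z Z'),
    fwd (assoc X' Y' Z') ∘ bmap tens (bmap tens f g) h =
    bmap tens f (bmap tens g h) ∘ fwd (assoc X Y Z);
  lunit_nat : forall X Y (f : hom X Y),
    fwd (lunit Y) ∘ bmap tens (idm munit) f = f ∘ fwd (lunit X);
  runit_nat : forall X Y (f : hom X Y),
    fwd (runit Y) ∘ bmap tens f (idm munit) = f ∘ fwd (runit X);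
  pentagon : forall X Y Z W,
    fwd (assoc X Y (tens Z W)) ∘ fwd (assoc (tens X Y) Z W) =
    bmap tens (idm X) (fwd (assoc Y Z W)) ∘ fwd (assoc X (tens Y Z) W)
      ∘ bmap tens (fwd (assoc X Y Z)) (idm W);
  triangle : forall X Y,
    bmap tens (idm X) (fwd (lunit Y)) ∘ fwd (assoc X munit Y) =
    bmap tens (fwd (runit X)) (idm Y)
}.
Arguments tens {k m}.
Arguments munit {k m}.
Arguments assoc {k m} X Y Z.
Arguments lunit {k m} X.
Arguments runit {k m} X.

Notation "X ⊗ Y" := (bobj tens X Y) (at level 35, right associativity) : cat_scope.
Notation "f ⊗m g" := (bmap tens f g) (at level 35, right associativity) : cat_scope.

(* [X'] is a left dual of [X] (equivalently, [X] is a right dual of [X']). *)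
Record duality (k : fieldType) (C : moncat k) (X' X : C) := Duality {
  ev : hom (X' ⊗ X) munit;
  coev : hom munit (X ⊗ X');
  duality_zig :
    fwd (runit X) ∘ (idm X ⊗m ev) ∘ fwd (assoc X X' X) ∘ (coev ⊗m idm X)
      ∘ bwd (lunit X) = idm X;
  duality_zag :
    fwd (lunit X') ∘ (ev ⊗m idm X') ∘ bwd (assoc X' X X') ∘ (idm X' ⊗m coev)
      ∘ bwd (runit X') = idm X'
}.

Record rigid (k : fieldType) (C : moncat k) := Rigid {
  ldual : C -> C;
  ldualP : forall X : C, duality (ldual X) X;
  rdual : C -> C;
  rdualP : forall X : C, duality X (rdual X)
}.

Record tensor_cat (k : fieldType) := TensorCat {
  tcat :> moncat k;
  tcat_finite : finite_abelian tcat;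
  tcat_rigid : rigid tcat;
  tcat_one : bijective (fun a : k => a *: idm (munit : tcat))
}.

Record fusion_cat (k : fieldType) := FusionCat {
  fcat :> tensor_cat k;
  fcat_semisimple : semisimple fcat
}.

Section Trace.
Context (k : fieldType) (C : tensor_cat k).

Definition dualobj (X : C) : C := ldual (tcat_rigid C) X.
Definition evd (X : C) : hom (dualobj X ⊗ X) munit := ev (ldualP (tcat_rigid C) X).
Definition coevd (X : C) : hom munit (X ⊗ dualobj X) := coev (ldualP (tcat_rigid C) X).

Definition dualm (X Y : C) (f : hom X Y) : hom (dualobj Y) (dualobj X) :=
  fwd (lunit (dualobj X)) ∘ (evd Y ⊗m idm (dualobj X))
    ∘ bwd (assoc (dualobj Y) Y (dualobj X))
    ∘ (idm (dualobj Y) ⊗m (f ⊗m idm (dualobj X)))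
    ∘ (idm (dualobj Y) ⊗m coevd X) ∘ bwd (runit (dualobj Y)).

(* The element [c] of [k] with [f = c *: idm munit]. *)
Definition scalar_of (f : hom (munit : C) munit) : k :=
  coord [tuple idm (munit : C)] ord0 f.

Definition trace (X : C) (a : hom X (dualobj (dualobj X))) : k :=
  scalar_of (evd (dualobj X) ∘ (a ⊗m idm (dualobj X)) ∘ coevd X).

(* [c] is the squared norm |X|^2; for simple [X] it does not depend on [a]. *)
Definition is_sqnorm (X : C) (c : k) : Prop :=
  exists a : iso X (dualobj (dualobj X)), c = trace (fwd a) * trace (dualm (bwd a)).

(* [S] lists the simple objects, each isomorphism class exactly once. *)
Definition simple_reps (n : nat) (S : 'I_n -> C) : Prop :=
  [/\ forall j, simple (S j),
      forall X : C, simple X -> exists j, isomorphic X (S j) &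
      forall j l, isomorphic (S j) (S l) -> j = l].

Definition is_global_dim (d : k) : Prop :=
  exists (n : nat) (S : 'I_n -> C) (c : 'I_n -> k),
    [/\ simple_reps S, forall j, is_sqnorm (S j) (c j) & d = \sum_(j < n) c j].

Definition separable : Prop := exists2 d : k, is_global_dim d & d != 0.

End Trace.

Record monfunctor (k : fieldType) (C D : moncat k) := MonFunctor {
  mfun :> linfunctor C D;
  mmul : forall X Y : C, iso (mfun X ⊗ mfun Y) (mfun (X ⊗ Y));
  mone : iso munit (mfun munit);
  mmul_nat : forall X X' Y Y' (f : hom X X') (g : hom Y Y'),
    fwd (mmul X' Y') ∘ (fmap mfun f ⊗m fmap mfun g) =
    fmap mfun (f ⊗m g) ∘ fwd (mmul X Y);
  mmulA : forall X Y Z,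
    fmap mfun (fwd (assoc X Y Z)) ∘ fwd (mmul (X ⊗ Y) Z)
      ∘ (fwd (mmul X Y) ⊗m idm (mfun Z)) =
    fwd (mmul X (Y ⊗ Z)) ∘ (idm (mfun X) ⊗m fwd (mmul Y Z))
      ∘ fwd (assoc (mfun X) (mfun Y) (mfun Z));
  mmul1l : forall X,
    fmap mfun (fwd (lunit X)) ∘ fwd (mmul munit X) ∘ (fwd mone ⊗m idm (mfun X)) =
    fwd (lunit (mfun X));
  mmul1r : forall X,
    fmap mfun (fwd (runit X)) ∘ fwd (mmul X munit) ∘ (idm (mfun X) ⊗m fwd mone) =
    fwd (runit (mfun X))
}.
Arguments mmul {k C D} m X Y.
Arguments mone {k C D} m.

Record tensor_functor (k : fieldType) (C D : moncat k) := TensorFunctor {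
  tfun :> monfunctor C D;
  tfun_exact : exact_functor tfun
}.

Record bimodcat (k : fieldType) (C : moncat k) := BimodCat {
  bmcat :> lincat k;
  lact : bifunctor C bmcat bmcat;
  ract : bifunctor bmcat C bmcat;
  lassoc : forall (X Y : C) (M : bmcat), iso (lact (X ⊗ Y) M) (lact X (lact Y M));
  lone : forall M : bmcat, iso (lact munit M) M;
  rassoc : forall (M : bmcat) (X Y : C), iso (ract (ract M X) Y) (ract M (X ⊗ Y));
  rone : forall M : bmcat, iso (ract M munit) M;
  massoc : forall (X : C) (M : bmcat) (Y : C),
    iso (ract (lact X M) Y) (lact X (ract M Y));
  lassoc_nat : forall X X' Y Y' M M' (f : hom X X') (g : hom Y Y') (h : hom M M'),
    fwd (lassoc X' Y' M') ∘ bmap lact (f ⊗m g) h =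
    bmap lact f (bmap lact g h) ∘ fwd (lassoc X Y M);
  lone_nat : forall M M' (h : hom M M'),
    fwd (lone M') ∘ bmap lact (idm munit) h = h ∘ fwd (lone M);
  rassoc_nat : forall M M' X X' Y Y' (h : hom M M') (f : hom X X') (g : hom Y Y'),
    fwd (rassoc M' X' Y') ∘ bmap ract (bmap ract h f) g =
    bmap ract h (f ⊗m g) ∘ fwd (rassoc M X Y);
  rone_nat : forall M M' (h : hom M M'),
    fwd (rone M') ∘ bmap ract h (idm munit) = h ∘ fwd (rone M);
  massoc_nat : forall X X' M M' Y Y' (f : hom X X') (h : hom M M') (g : hom Y Y'),
    fwd (massoc X' M' Y') ∘ bmap ract (bmap lact f h) g =
    bmap lact f (bmap ract h g) ∘ fwd (massoc X M Y);
  lassoc_pentagon : forall X Y Z M,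
    fwd (lassoc X Y (lact Z M)) ∘ fwd (lassoc (X ⊗ Y) Z M) =
    bmap lact (idm X) (fwd (lassoc Y Z M)) ∘ fwd (lassoc X (Y ⊗ Z) M)
      ∘ bmap lact (fwd (assoc X Y Z)) (idm M);
  lone_triangle : forall X M,
    bmap lact (idm X) (fwd (lone M)) ∘ fwd (lassoc X munit M) =
    bmap lact (fwd (runit X)) (idm M);
  rassoc_pentagon : forall M X Y Z,
    fwd (rassoc M X (Y ⊗ Z)) ∘ fwd (rassoc (ract M X) Y Z) =
    bmap ract (idm M) (fwd (assoc X Y Z)) ∘ fwd (rassoc M (X ⊗ Y) Z)
      ∘ bmap ract (fwd (rassoc M X Y)) (idm Z);
  rone_triangle : forall M X,
    bmap ract (idm M) (fwd (lunit X)) ∘ fwd (rassoc M munit X) =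
    bmap ract (fwd (rone M)) (idm X);
  massoc_lpentagon : forall X Y M Z,
    fwd (lassoc X Y (ract M Z)) ∘ fwd (massoc (X ⊗ Y) M Z) =
    bmap lact (idm X) (fwd (massoc Y M Z)) ∘ fwd (massoc X (lact Y M) Z)
      ∘ bmap ract (fwd (lassoc X Y M)) (idm Z);
  massoc_rpentagon : forall X M Y Z,
    fwd (massoc X M (Y ⊗ Z)) ∘ fwd (rassoc (lact X M) Y Z) =
    bmap lact (idm X) (fwd (rassoc M Y Z)) ∘ fwd (massoc X (ract M Y) Z)
      ∘ bmap ract (fwd (massoc X M Y)) (idm Z)
}.
Arguments lact {k C b}.
Arguments ract {k C b}.
Arguments lassoc {k C b} X Y M.
Arguments lone {k C b} M.
Arguments rassoc {k C b} M X Y.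
Arguments rone {k C b} M.
Arguments massoc {k C b} X M Y.

Notation "X ▷ M" := (bobj lact X M) (at level 36, right associativity) : cat_scope.
Notation "M ◁ X" := (bobj ract M X) (at level 37, left associativity) : cat_scope.
Notation "f ▷m h" := (bmap lact f h) (at level 36, right associativity) : cat_scope.
Notation "h ◁m f" := (bmap ract h f) (at level 37, left associativity) : cat_scope.

Definition regular_bimod (k : fieldType) (C : moncat k) : bimodcat C :=
  @BimodCat k C C tens tens assoc lunit assoc runit assoc
    (@assoc_nat k C) (@lunit_nat k C) (@assoc_nat k C) (@runit_nat k C)
    (@assoc_nat k C) (@pentagon k C) (@triangle k C) (@pentagon k C)
    (@triangle k C) (@pentagon k C) (@pentagon k C).

Section Restrict.
Context (k : fieldType) (C D : moncat k) (F : monfunctor C D) (M : bimodcat D).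

Lemma mmulV_nat (X X' Y Y' : C) (f : hom X X') (g : hom Y Y') :
  bwd (mmul F X' Y') ∘ fmap F (f ⊗m g) =
  (fmap F f ⊗m fmap F g) ∘ bwd (mmul F X Y).
Proof.
rewrite -[LHS]compm1 -(bwdK (mmul F X Y)) -compA (compA (fmap F _)) -mmul_nat.
by rewrite !compA fwdK comp1m.
Qed.

Definition res_lact : bifunctor C M M := bifunctor_comp lact F (idfunctor M).
Definition res_ract : bifunctor M C M := bifunctor_comp ract (idfunctor M) F.

Definition res_lassoc (X Y : C) (m : M) :
    iso (res_lact (X ⊗ Y) m) (res_lact X (res_lact Y m)) :=
  iso_comp (lassoc (F X) (F Y) m)
    (iso_bmap lact (iso_sym (mmul F X Y)) (iso_id m)).

Definition res_lone (m : M) : iso (res_lact munit m) m :=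
  iso_comp (lone m) (iso_bmap lact (iso_sym (mone F)) (iso_id m)).

Definition res_rassoc (m : M) (X Y : C) :
    iso (res_ract (res_ract m X) Y) (res_ract m (X ⊗ Y)) :=
  iso_comp (iso_bmap ract (iso_id m) (mmul F X Y)) (rassoc m (F X) (F Y)).

Definition res_rone (m : M) : iso (res_ract m munit) m :=
  iso_comp (rone m) (iso_bmap ract (iso_id m) (iso_sym (mone F))).

Definition res_massoc (X : C) (m : M) (Y : C) :
    iso (res_ract (res_lact X m) Y) (res_lact X (res_ract m Y)) :=
  massoc (F X) m (F Y).

Lemma mmulVA (X Y Z : C) :
  fwd (assoc (F X) (F Y) (F Z)) ∘ (bwd (mmul F X Y) ⊗m idm (F Z))
    ∘ bwd (mmul F (X ⊗ Y) Z) =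
  (idm (F X) ⊗m bwd (mmul F Y Z)) ∘ bwd (mmul F X (Y ⊗ Z))
    ∘ fmap F (fwd (assoc X Y Z)).
Proof.
have E : (idm (F X) ⊗m bwd (mmul F Y Z)) ∘ bwd (mmul F X (Y ⊗ Z))
    ∘ (fwd (mmul F X (Y ⊗ Z)) ∘ (idm (F X) ⊗m fwd (mmul F Y Z))
        ∘ fwd (assoc (F X) (F Y) (F Z))) = fwd (assoc (F X) (F Y) (F Z)).
  rewrite !compA -(compA _ (bwd _)) fwdK compm1 -bmapM comp1m fwdK bmap1.
  exact: comp1m.
rewrite -[in LHS]E -mmulA -!compA (compA (fwd _ ⊗m _)) -bmapM bwdK comp1m bmap1.
by rewrite comp1m bwdK compm1.
Qed.

Lemma mmulV1l (X : C) :
  fwd (lunit (F X)) ∘ (bwd (mone F) ⊗m idm (F X)) ∘ bwd (mmul F munit X) =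
  fmap F (fwd (lunit X)).
Proof.
rewrite -mmul1l -(compA _ _ (_ ⊗m _)) -bmapM bwdK comp1m bmap1 compm1.
by rewrite -compA bwdK compm1.
Qed.

Lemma mmulV1r (X : C) :
  fwd (runit (F X)) ∘ (idm (F X) ⊗m bwd (mone F)) ∘ bwd (mmul F X munit) =
  fmap F (fwd (runit X)).
Proof.
rewrite -mmul1r -(compA _ _ (_ ⊗m _)) -bmapM bwdK comp1m bmap1 compm1.
by rewrite -compA bwdK compm1.
Qed.

Definition restrict_bimod : bimodcat C.
Proof.
exists M res_lact res_ract res_lassoc res_lone res_rassoc res_rone res_massoc => /=.
- move=> X X' Y Y' m m' f g h; rewrite -compA -bmapM mmulV_nat.
  have -> : idm m' ∘ h = h ∘ idm m by rewrite comp1m compm1.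
  by rewrite bmapM !compA lassoc_nat.
- move=> m m' h; rewrite fmap1 -compA -bmapM compm1.
  have -> : idm m' ∘ h = h ∘ idm m by rewrite comp1m compm1.
  by rewrite -[bwd _]comp1m bmapM !compA lone_nat comp1m.
- move=> m m' X X' Y Y' h f g.
  rewrite -compA rassoc_nat !compA -!bmapM mmul_nat.
  by have -> : idm m' ∘ h = h ∘ idm m by rewrite comp1m compm1.
- move=> m m' h; rewrite fmap1 -compA -bmapM compm1.
  have -> : idm m' ∘ h = h ∘ idm m by rewrite comp1m compm1.
  by rewrite -[bwd _]comp1m bmapM !compA rone_nat comp1m.
- by move=> *; rewrite massoc_nat.
- move=> X Y Z m; rewrite fmap1 -(bmap1 lact) bmapMr -!compA.
  rewrite !compA -(compA _ (_ ▷m _)) -lassoc_nat compA lassoc_pentagon.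
  rewrite -(compA _ (idm (F X) ▷m _)) -lassoc_nat -!compA -!bmapMl.
  by rewrite !compA mmulVA.
- move=> X m; rewrite fmap1 bmapMr -!compA (compA (_ ▷m (_ ▷m _))) -lassoc_nat.
  by rewrite !compA lone_triangle -!compA -!bmapMl compA mmulV1r.
- move=> m X Y Z; rewrite fmap1 bmapMl -(bmap1 ract) !compA.
  rewrite -[in RHS](compA _ (fwd (rassoc m (F (X ⊗ Y)) (F Z)))) rassoc_nat.
  rewrite -[in LHS](compA _ (fwd (rassoc m (F X) (F (Y ⊗ Z))))) rassoc_nat.
  by rewrite -!compA rassoc_pentagon !compA -!bmapMr -mmulA.
- move=> m X; rewrite fmap1 bmapMl.
  rewrite -rone_triangle -(compA _ (fwd _)) rassoc_nat !compA -!bmapMr.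
  congr (_ ∘ _); congr bmap.
  rewrite -mmul1l -(compA _ _ (bwd (mone F) ⊗m _)) -bmapM bwdK comp1m bmap1.
  by rewrite compm1.
- move=> X Y m Z; rewrite /res_massoc !fmap1 bmapMl -(bmap1 ract) -!compA.
  rewrite -massoc_nat compA massoc_lpentagon.
  by rewrite -!compA.
- move=> X m Y Z; rewrite /res_massoc !fmap1 bmapMr -(bmap1 lact) !compA.
  by rewrite massoc_nat -!compA massoc_rpentagon !compA.
Defined.

End Restrict.

Record bimodfunctor (k : fieldType) (C : moncat k) (M N : bimodcat C) :=
  BimodFunctor {
  bfun :> linfunctor M N;
  lstr : forall (X : C) (m : M), iso (X ▷ bfun m) (bfun (X ▷ m));
  rstr : forall (m : M) (X : C), iso (bfun m ◁ X) (bfun (m ◁ X));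
  lstr_nat : forall X X' m m' (f : hom X X') (h : hom m m'),
    fwd (lstr X' m') ∘ (f ▷m fmap bfun h) = fmap bfun (f ▷m h) ∘ fwd (lstr X m);
  rstr_nat : forall m m' X X' (h : hom m m') (f : hom X X'),
    fwd (rstr m' X') ∘ (fmap bfun h ◁m f) = fmap bfun (h ◁m f) ∘ fwd (rstr m X);
  lstrA : forall X Y m,
    fmap bfun (fwd (lassoc X Y m)) ∘ fwd (lstr (X ⊗ Y) m) =
    fwd (lstr X (Y ▷ m)) ∘ (idm X ▷m fwd (lstr Y m)) ∘ fwd (lassoc X Y (bfun m));
  lstr1 : forall m,
    fmap bfun (fwd (lone m)) ∘ fwd (lstr munit m) = fwd (lone (bfun m));
  rstrA : forall m X Y,
    fmap bfun (fwd (rassoc m X Y)) ∘ fwd (rstr (m ◁ X) Y)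
      ∘ (fwd (rstr m X) ◁m idm Y) =
    fwd (rstr m (X ⊗ Y)) ∘ fwd (rassoc (bfun m) X Y);
  rstr1 : forall m,
    fmap bfun (fwd (rone m)) ∘ fwd (rstr m munit) = fwd (rone (bfun m));
  mstrA : forall X m Y,
    fmap bfun (fwd (massoc X m Y)) ∘ fwd (rstr (X ▷ m) Y)
      ∘ (fwd (lstr X m) ◁m idm Y) =
    fwd (lstr X (m ◁ Y)) ∘ (idm X ▷m fwd (rstr m Y))
      ∘ fwd (massoc X (bfun m) Y)
}.
Arguments lstr {k C M N} b X m.
Arguments rstr {k C M N} b m X.

Definition idbimod (k : fieldType) (C : moncat k) (M : bimodcat C) :
  bimodfunctor M M.
Proof.
exists (idfunctor M) (fun X m => iso_id (X ▷ m)) (fun m X => iso_id (m ◁ X)) => /=.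
- by move=> *; rewrite comp1m compm1.
- by move=> *; rewrite comp1m compm1.
- by move=> *; rewrite bmap1 !comp1m compm1.
- by move=> *; rewrite compm1.
- by move=> *; rewrite bmap1 !comp1m !compm1.
- by move=> *; rewrite compm1.
- by move=> *; rewrite !bmap1 !comp1m !compm1.
Defined.

Definition compbimod (k : fieldType) (C : moncat k) (M N P : bimodcat C)
  (G : bimodfunctor N P) (H : bimodfunctor M N) : bimodfunctor M P.
Proof.
exists (compfunctor G H)
  (fun X m => iso_comp (iso_fmap G (lstr H X m)) (lstr G X (H m)))
  (fun m X => iso_comp (iso_fmap G (rstr H m X)) (rstr G (H m) X)) => /=.
- by move=> *; rewrite -compA lstr_nat !compA -!fmapM lstr_nat.
- by move=> *; rewrite -compA rstr_nat !compA -!fmapM rstr_nat.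
- move=> X Y m; rewrite !compA -fmapM lstrA bmapMr !compA.
  rewrite -(compA _ (fwd (lstr G X (H (Y ▷ m))))) lstr_nat !fmapM -!compA.
  by rewrite lstrA -!compA.
- by move=> m; rewrite !compA -fmapM lstr1 lstr1.
- move=> m X Y; rewrite bmapMl !compA -fmapM.
  rewrite -(compA _ (fwd (rstr G (H (m ◁ X)) Y))) rstr_nat !compA -!fmapM.
  by rewrite rstrA fmapM -!compA (compA _ _ (_ ◁m _)) rstrA.
- by move=> m; rewrite !compA -fmapM rstr1 rstr1.
- move=> X m Y; rewrite bmapMl bmapMr !compA -fmapM.
  rewrite -(compA _ (fwd (rstr G (H (X ▷ m)) Y))) rstr_nat !compA -!fmapM.
  rewrite mstrA -(compA _ (fwd (lstr G X (H (m ◁ Y))))) lstr_nat.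
  by rewrite !fmapM -!compA (compA _ _ (_ ◁m _)) mstrA -!compA.
Defined.

Record bimodtrans (k : fieldType) (C : moncat k) (M N : bimodcat C)
    (H K : bimodfunctor M N) := BimodTrans {
  bcomp :> forall m : M, hom (H m) (K m);
  bcomp_nat : forall m m' (h : hom m m'),
    bcomp m' ∘ fmap H h = fmap K h ∘ bcomp m;
  bcomp_l : forall X m,
    bcomp (X ▷ m) ∘ fwd (lstr H X m) = fwd (lstr K X m) ∘ (idm X ▷m bcomp m);
  bcomp_r : forall m X,
    bcomp (m ◁ X) ∘ fwd (rstr H m X) = fwd (rstr K m X) ∘ (bcomp m ◁m idm X)
}.

Definition bimod_isomorphic (k : fieldType) (C : moncat k) (M N : bimodcat C)
    (H K : bimodfunctor M N) : Prop :=
  exists t : bimodtrans H K, forall m : M, is_iso (t m).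

(* An adjunction whose unit and counit are bimodule transformations.  For
   rigid [C], an adjoint of a bimodule functor carries exactly one bimodule
   functor structure with this property: its canonical one. *)
Record bimod_adjunction (k : fieldType) (C : moncat k) (M N : bimodcat C)
    (L : bimodfunctor M N) (R : bimodfunctor N M) := BimodAdjunction {
  adj_unit : bimodtrans (idbimod M) (compbimod R L);
  adj_counit : bimodtrans (compbimod L R) (idbimod N);
  adj_zig : forall m : M, adj_counit (L m) ∘ fmap L (adj_unit m) = idm (L m);
  adj_zag : forall n : N, fmap R (adj_counit n) ∘ adj_unit (R n) = idm (R n)
}.

Section Frobenius.
Context (k : fieldType) (C D : moncat k) (F : tensor_functor C D).

(* [D] as a [C]-bimodule category: [X ▷ d ◁ Y = F X ⊗ d ⊗ F Y]. *)
Definition target_bimod : bimodcat C := restrict_bimod F (regular_bimod D).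

Definition tensor_bimodfunctor : bimodfunctor (regular_bimod C) target_bimod.
Proof.
refine (@BimodFunctor k C (regular_bimod C) target_bimod F (mmul F) (mmul F)
  _ _ _ _ _ _ _) => /=.
- exact: mmul_nat.
- exact: mmul_nat.
- move=> X Y Z; rewrite fmap1 !compA -mmulA.
  by rewrite -(compA _ (_ ⊗m _)) -bmapMl bwdK bmap1 compm1.
- move=> X; rewrite -mmul1l -!compA.
  by rewrite -bmapMl bwdK bmap1 compm1.
- by move=> X Y Z; rewrite fmap1 mmulA -compA.
- by move=> X; rewrite -mmul1r -!compA -bmapMr bwdK bmap1 compm1.
- by move=> X Y Z; rewrite !fmap1 mmulA.
Defined.

(* The adjoints are unique up to isomorphism of bimodule functors. *)
Definition tensor_frobenius : Prop :=
  exists (Fla Fra : bimodfunctor target_bimod (regular_bimod C)),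
    [/\ inhabited (bimod_adjunction Fla tensor_bimodfunctor),
        inhabited (bimod_adjunction tensor_bimodfunctor Fra) &
        bimod_isomorphic Fla Fra].

End Frobenius.

(* Main.v *)
From HB Require Import structures.
From Stdlib Require Import ClassicalEpsilon.
From mathcomp Require Import all_boot all_order all_algebra.
Require Import Defs.
Set Implicit Arguments. Unset Strict Implicit. Unset Printing Implicit Defensive.
Import GRing.Theory.
Local Open Scope ring_scope.
Local Open Scope cat_scope.

(* Let R be right adjoint to F.  By its universal property R is a bimodule functor
   and F -| R is a bimodule adjunction; the same R is shown to be left adjoint to F.
   For this one needs a linear map E : Hom(F T, F X) -> Hom(T, X) which is natural
   in C, compatible with tensoring on both sides, and satisfies E (F f) = f.  Since
   Hom(1, 1) = Hom(F 1, F 1) = k and C is semisimple and rigid, there is exactly one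
   natural E compatible with tensoring on the right.  Averaging its left partial
   traces over the simple objects S_i, with the right circle of S_i as weight, makes
   it compatible with tensoring on the left as well.  The left circle times the right
   circle of S_i is |S_i|^2, so E (F f) becomes f times the global dimension of C, and
   separability allows one to normalize.  Finally, with eps : F R -> id the counit,
   v |-> E (v eps_d) is an isomorphism Hom(d, F X) -> Hom(R d, X): it is injective
   since E is a nondegenerate pairing, and both sides have the same dimension; it
   exhibits R as a left adjoint of F. *)

(** * Linear categories *)

(** Testing against objects tensored on the right pins down an expectation that commutes with
    tensoring on the right, but nothing in its construction refers to the left action; that is the
    obstacle. No pivotal structure is available to compare the two sides: the isomorphisms from the
    simple objects to their double duals are chosen one at a time, with no compatibility with tensor
    products. The weight repairs this: rescaling such an isomorphism multiplies the right circle by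
    a scalar and the left partial trace by its inverse, so each summand of the average is
    independent of the choice. Left compatibility then comes from changing dual bases of
    [Hom(S_j, S_i ⊗ Y)], where a quotient of two right circles appears and is absorbed by the
    weights. The normalized average still satisfies the conditions that determine the
    right-compatible expectation, so it is the same map: averaging proves that this map is
    two-sided. *)

Section LinearityOfComposition.
Context (k : fieldType) (A : lincat k).
Implicit Types X Y Z W : A.

Lemma compDl X Y Z (f : hom X Y) (g h : hom Y Z) : (g + h) ∘ f = g ∘ f + h ∘ f.
Proof. by have := comp_linl f 1 g h; rewrite !scale1r. Qed.

Lemma compDr X Y Z (f : hom Y Z) (g h : hom X Y) : f ∘ (g + h) = f ∘ g + f ∘ h.
Proof. by have := comp_linr f 1 g h; rewrite !scale1r. Qed.

Lemma comp0m X Y Z (f : hom X Y) : (0 : hom Y Z) ∘ f = 0.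
Proof. by apply: (addrI (0 ∘ f)); rewrite -compDl !addr0. Qed.

Lemma compm0 X Y Z (f : hom Y Z) : f ∘ (0 : hom X Y) = 0.
Proof. by apply: (addrI (f ∘ 0)); rewrite -compDr !addr0. Qed.

Lemma compZl X Y Z (f : hom X Y) (g : hom Y Z) c : (c *: g) ∘ f = c *: (g ∘ f).
Proof. by have := comp_linl f c g 0; rewrite comp0m !addr0. Qed.

Lemma compZr X Y Z (f : hom Y Z) (g : hom X Y) c : f ∘ (c *: g) = c *: (f ∘ g).
Proof. by have := comp_linr f c g 0; rewrite compm0 !addr0. Qed.

Lemma compBl X Y Z (f : hom X Y) (g h : hom Y Z) : (g - h) ∘ f = g ∘ f - h ∘ f.
Proof. by rewrite compDl -scaleN1r compZl scaleN1r. Qed.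

Lemma compBr X Y Z (f : hom Y Z) (g h : hom X Y) : f ∘ (g - h) = f ∘ g - f ∘ h.
Proof. by rewrite compDr -scaleN1r compZr scaleN1r. Qed.

Lemma comp_suml X Y Z (f : hom X Y) n (F : 'I_n -> hom Y Z) :
  (\sum_i F i) ∘ f = \sum_i (F i ∘ f).
Proof. by apply: (big_morph (fun g : hom Y Z => g ∘ f)) => [g h|]; rewrite ?compDl ?comp0m. Qed.

Lemma comp_sumr X Y Z (f : hom Y Z) n (F : 'I_n -> hom X Y) :
  f ∘ (\sum_i F i) = \sum_i (f ∘ F i).
Proof. by apply: (big_morph (fun g : hom X Y => f ∘ g)) => [g h|]; rewrite ?compDr ?compm0. Qed.

(** Composites are kept left-associated, where the last factors do not form a subterm; [post]
    followed by two digits m and n replaces the last m factors of a longer composite by n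
    factors. *)
Lemma post21 X Y Z W (f : hom X Y) (g : hom Y Z) (r : hom X Z) (h : hom Z W) :
  g ∘ f = r -> h ∘ g ∘ f = h ∘ r.
Proof. by move=> <-; rewrite compA. Qed.

Lemma post22 X Y Y' Z W (f : hom X Y) (g : hom Y Z) (f' : hom X Y')
    (g' : hom Y' Z) (h : hom Z W) :
  g ∘ f = g' ∘ f' -> h ∘ g ∘ f = h ∘ g' ∘ f'.
Proof. by move=> e; rewrite -compA e compA. Qed.

Lemma post31 X Y Y' Z W (f : hom X Y) (g : hom Y Y') (g' : hom Y' Z)
    (r : hom X Z) (h : hom Z W) :
  g' ∘ g ∘ f = r -> h ∘ g' ∘ g ∘ f = h ∘ r.
Proof. by move=> <-; rewrite !compA. Qed.

Lemma iso_fwd_inj X Y Z (i : iso Y Z) (f g : hom X Y) :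
  fwd i ∘ f = fwd i ∘ g -> f = g.
Proof. by move=> /(congr1 (mcomp (bwd i))); rewrite !compA fwdK !comp1m. Qed.

Lemma iso_bwd_inj X Y Z (i : iso Z Y) (f g : hom X Y) :
  bwd i ∘ f = bwd i ∘ g -> f = g.
Proof. exact: (@iso_fwd_inj _ _ _ (iso_sym i)). Qed.

Lemma fwd_iso_inj X Y Z (i : iso X Y) (f g : hom Y Z) :
  f ∘ fwd i = g ∘ fwd i -> f = g.
Proof. by move=> /(congr1 (mcomp^~ (bwd i))); rewrite -!compA bwdK !compm1. Qed.

Lemma bwd_iso_inj X Y Z (i : iso Y X) (f g : hom Y Z) :
  f ∘ bwd i = g ∘ bwd i -> f = g.
Proof. exact: (@fwd_iso_inj _ _ _ (iso_sym i)). Qed.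

Lemma iso_conj X X' Y Y' (i : iso X Y) (j : iso X' Y') (f : hom X X')
    (g : hom Y Y') : fwd j ∘ f = g ∘ fwd i -> f ∘ bwd i = bwd j ∘ g.
Proof.
move=> e; apply: (iso_fwd_inj (i := j)); rewrite !compA bwdK comp1m e.
by rewrite -compA bwdK compm1.
Qed.

End LinearityOfComposition.

Section LinearityOfFunctors.
Context (k : fieldType) (A B E : lincat k).

Lemma fmapD (F : linfunctor A B) X Y (f g : hom X Y) :
  fmap F (f + g) = fmap F f + fmap F g.
Proof. by have := fmap_lin F 1 f g; rewrite !scale1r. Qed.

Lemma fmap0 (F : linfunctor A B) X Y : fmap F (0 : hom X Y) = 0.
Proof. by apply: (addrI (fmap F 0)); rewrite -fmapD !addr0. Qed.

Lemma fmapZ (F : linfunctor A B) X Y (f : hom X Y) c :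
  fmap F (c *: f) = c *: fmap F f.
Proof. by have := fmap_lin F c f 0; rewrite fmap0 !addr0. Qed.

Lemma fmap_sum (F : linfunctor A B) X Y n (G : 'I_n -> hom X Y) :
  fmap F (\sum_i G i) = \sum_i fmap F (G i).
Proof. by apply: (big_morph (fun g : hom X Y => fmap F g)) => [g h|]; rewrite ?fmapD ?fmap0. Qed.

Definition fun_l (T : bifunctor A B E) (X : A) : linfunctor B E.
Proof.
exists (fun Y => T X Y) (fun _ _ g => bmap T (idm X) g).
- by move=> Y; apply: bmap1.
- by move=> *; apply: bmapMr.
- by move=> Y Y'; apply: bmap_linr.
Defined.

Definition fun_r (T : bifunctor A B E) (Y : B) : linfunctor A E.
Proof.
exists (fun X => T X Y) (fun _ _ f => bmap T f (idm Y)).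
- by move=> X; apply: bmap1.
- by move=> *; apply: bmapMl.
- by move=> X X'; apply: bmap_linl.
Defined.

Lemma bmap0l (T : bifunctor A B E) X X' Y Y' (g : hom Y Y') :
  bmap T (0 : hom X X') g = 0.
Proof.
have := bmap_linl T g 1 (0 : hom X X') 0; rewrite !scale1r addr0 => e.
by apply: (addrI (bmap T 0 g)); rewrite -e addr0.
Qed.

Lemma bmap0r (T : bifunctor A B E) X X' Y Y' (f : hom X X') :
  bmap T f (0 : hom Y Y') = 0.
Proof.
have := bmap_linr T f 1 (0 : hom Y Y') 0; rewrite !scale1r addr0 => e.
by apply: (addrI (bmap T f 0)); rewrite -e addr0.
Qed.

Lemma bmapDl (T : bifunctor A B E) X X' Y Y' (f f' : hom X X') (g : hom Y Y') :
  bmap T (f + f') g = bmap T f g + bmap T f' g.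
Proof. by have := bmap_linl T g 1 f f'; rewrite !scale1r. Qed.

Lemma bmapDr (T : bifunctor A B E) X X' Y Y' (f : hom X X') (g g' : hom Y Y') :
  bmap T f (g + g') = bmap T f g + bmap T f g'.
Proof. by have := bmap_linr T f 1 g g'; rewrite !scale1r. Qed.

Lemma bmapZl (T : bifunctor A B E) X X' Y Y' (f : hom X X') (g : hom Y Y') c :
  bmap T (c *: f) g = c *: bmap T f g.
Proof. by have := bmap_linl T g c f 0; rewrite bmap0l !addr0. Qed.

Lemma bmapZr (T : bifunctor A B E) X X' Y Y' (f : hom X X') (g : hom Y Y') c :
  bmap T f (c *: g) = c *: bmap T f g.
Proof. by have := bmap_linr T f c g 0; rewrite bmap0r !addr0. Qed.

Lemma bmap_suml (T : bifunctor A B E) X X' Y Y' (g : hom Y Y') n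
    (F : 'I_n -> hom X X') :
  bmap T (\sum_i F i) g = \sum_i bmap T (F i) g.
Proof.
apply: (big_morph (fun f => bmap T f g)) => [f f'|]; [exact: bmapDl | exact: bmap0l].
Qed.

Lemma bmap_sumr (T : bifunctor A B E) X X' Y Y' (f : hom X X') n
    (F : 'I_n -> hom Y Y') :
  bmap T f (\sum_i F i) = \sum_i bmap T f (F i).
Proof.
apply: (big_morph (bmap T f)) => [g g'|]; [exact: bmapDr | exact: bmap0r].
Qed.

Lemma bmap_lr (T : bifunctor A B E) X X' Y Y' (f : hom X X') (g : hom Y Y') :
  bmap T f (idm Y') ∘ bmap T (idm X) g = bmap T f g.
Proof. by rewrite -bmapM compm1 comp1m. Qed.

Lemma bmap_rl (T : bifunctor A B E) X X' Y Y' (f : hom X X') (g : hom Y Y') :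
  bmap T (idm X') g ∘ bmap T f (idm Y) = bmap T f g.
Proof. by rewrite -bmapM compm1 comp1m. Qed.

End LinearityOfFunctors.

Definition has_kernels (k : fieldType) (A : lincat k) := forall (X Y : A) (f : hom X Y),
  exists (K : A) (i : hom K X), is_kernel i f.

(** * Schur's lemma *)

Section Semisimple.
Context (k : fieldType) (A : lincat k).
Hypothesis kerA : has_kernels A.
Implicit Types X Y Z S T : A.

Lemma kernel_mono K X Y (i : hom K X) (f : hom X Y) : is_kernel i f -> mono i.
Proof.
move=> [fi0 ker] T g h e.
have [u [_ uu]] : exists! h' : hom T K, i ∘ h' = i ∘ g.
  by apply: ker; rewrite compA fi0 comp0m.
by rewrite -(uu g erefl) -(uu h (esym e)).
Qed.

Lemma zero_hom X Y (f : hom X Y) : is_zero X -> f = 0.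
Proof. by move=> z; rewrite -[f]compm1 z compm0. Qed.

(** Simplicity of [T] is a statement about monos into [T], so it suffices that [f] is mono. The
    kernel of [f] is either zero or all of [S], and the latter would force [f = 0]. *)
Lemma schur S T (f : hom S T) : simple S -> simple T -> f != 0 -> is_iso f.
Proof.
move=> [nzS simS] [_ simT] fn0.
suff /simT[|//] : mono f by move=> z; case: nzS.
have [K [i ki]] := kerA f.
have [zK|[j [_ ij]]] := simS _ i (kernel_mono ki); last first.
  case/eqP: fn0; rewrite -[f]compm1 -ij compA.
  by case: ki => -> _; rewrite comp0m.
move=> Q g h e; apply/eqP; rewrite -subr_eq0; apply/eqP.
have [|u [<- _]] := (ki.2 Q (g - h)); first by rewrite compBr e subrr.
by rewrite (zero_hom i zK) comp0m.
Qed.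

(** Of the unit object and of its image under [F] only the endomorphisms are given, so the arguments
    about them rest on this property rather than on simplicity. *)
Definition brick X := (idm X != 0) /\ forall f : hom X X, exists c, f = c *: idm X.

Lemma simple_id_neq0 S : simple S -> idm S != 0.
Proof. by case=> nz _; apply/eqP. Qed.

End Semisimple.

(** * Finite-dimensional linear algebra *)

Section LinearAlgebra.
Import VectorInternalTheory.

Lemma linear_eigenvector (k : closedFieldType) (V : vectType k) (phi : V -> V)
    (lin : linear phi) (v0 : V) :
  v0 != 0 -> exists c v, v != 0 /\ phi v = c *: v.
Proof.
move=> nz; pose f : {linear V -> V} :=
  HB.pack phi (GRing.isLinear.Build k V V *:%R phi lin).
pose M := lin1_mx (v2r \o f \o r2v).
have n_gt0 : (0 < dim V)%N.
  case: (posnP (dim V)) => // d0; case/eqP: nz; apply: v2r_inj; apply/rowP.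
  by case=> i lti; exfalso; move: lti; rewrite d0.
have /closed_rootP[c] : size (char_poly M) != 1%N.
  by rewrite size_char_poly eqSS -lt0n.
rewrite -eigenvalue_root_char => /eigenvalueP[x xM xnz].
exists c, (r2v x); split.
  by apply: contra_neq xnz => e; rewrite -[x]r2vK e linear0.
have fM : v2r (f (r2v x)) = c *: x by rewrite -xM mul_rV_lin1.
by rewrite -[phi _]v2rK fM linearZ.
Qed.

(** Nondegeneracy on the side of [V] says that the Gram matrix has rank [dim V]; its rows, which are
    functionals [b u], then span the dual of [V]. *)
Lemma represent_functional (k : fieldType) (U V : vectType k) (b : U -> V -> k)
    (linl : forall v, scalar (b^~ v)) (linr : forall u, scalar (b u))
    (nondeg : forall v, (forall u, b u v = 0) -> v = 0)
    (lam : V -> k) (linlam : scalar lam) :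
  exists u, forall v, b u v = lam v.
Proof.
have row_sum (W : vectType k) (l : W -> k) : scalar l ->
    forall x : 'rV_(dim W), l (r2v x) = \sum_j x 0 j * l (r2v (delta_mx 0 j)).
  move=> ll x; pose g : {scalar W} :=
    HB.pack l (GRing.isLinear.Build k W k *%R l ll).
  rewrite {1}[x]row_sum_delta (_ : l = g) // !linear_sum.
  by apply: eq_bigr => j _; rewrite !linearZ.
pose B := \matrix_(i < dim U, j < dim V) b (r2v (delta_mx 0 i)) (r2v (delta_mx 0 j)).
have full : row_full B.
  rewrite /row_full -mxrank_tr -/(row_free B^T) -kermx_eq0; apply/rowV0P => x /sub_kermxP xB.
  suff e : r2v x = 0 by rewrite -[x]r2vK e linear0.
  apply: nondeg => u; rewrite -[u]v2rK (row_sum _ _ (linl _)) big1 // => i _.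
  rewrite (row_sum _ _ (linr _)); have := congr1 (fun m : 'rV_ _ => m 0 i) xB.
  rewrite !mxE => e; rewrite [X in _ * X](_ : _ = 0) ?mulr0 // -[RHS]e.
  by apply: eq_bigr => j _; rewrite !mxE.
have /row_fullP[B' B'K] := full.
pose y : 'rV_(dim V) := \row_j lam (r2v (delta_mx 0 j)).
exists (r2v (y *m B')) => v; rewrite -[v]v2rK.
rewrite (row_sum _ _ (linr _)) (row_sum _ _ linlam); apply: eq_bigr => j _.
congr (_ * _); rewrite (row_sum _ _ (linl _)).
have := congr1 (fun m : 'rV_ _ => m 0 j) (mulmxA y B' B).
rewrite B'K mulmx1 !mxE => ->; apply: eq_bigr => i _; by rewrite !mxE.
Qed.

Lemma linear_inj_surj (k : fieldType) (V W : vectType k) (f : V -> W) (g : W -> V) :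
  linear f -> linear g -> (forall v, f v = 0 -> v = 0) ->
  (forall w, g w = 0 -> w = 0) -> forall w, exists v, f v = w.
Proof.
move=> lf lg f0 g0 w.
pose f' : {linear V -> W} := HB.pack f (GRing.isLinear.Build k V W *:%R f lf).
pose g' : {linear W -> V} := HB.pack g (GRing.isLinear.Build k W V *:%R g lg).
have kf : lker (linfun f') = 0%VS.
  by apply/eqP; rewrite -subv0; apply/subvP => v; rewrite memv_ker memv0 lfunE => /eqP/f0->.
have kg : lker (linfun g') = 0%VS.
  by apply/eqP; rewrite -subv0; apply/subvP => v; rewrite memv_ker memv0 lfunE => /eqP/g0->.
have := limg_dim_eq (f := linfun g') (U := fullv); rewrite kg capv0 => /(_ erefl) dg.
have := limg_dim_eq (f := linfun f') (U := fullv); rewrite kf capv0 => /(_ erefl) df.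
have im : limg (linfun f') = fullv.
  by apply/eqP; rewrite eqEdim subvf df -dg dimvS ?subvf.
have : w \in limg (linfun f') by rewrite im memvf.
by case/memv_imgP => v _ ->; exists v; rewrite lfunE.
Qed.

End LinearAlgebra.

(** * Semisimple categories over an algebraically closed field *)

Section SemisimpleCategories.
Context (k : closedFieldType) (A : lincat k).
Hypothesis kerA : has_kernels A.
Hypothesis ssA : semisimple A.
Implicit Types X Y Z W : A.

(** The eigenvalue is taken for composition with [f] on the space [End(X)]: a nonzero eigenvector
    [v] shows that [f - c] is not invertible, hence is zero by Schur. *)
Lemma simple_brick X : simple X -> brick X.
Proof.
move=> simX; split=> [|f]; first exact: simple_id_neq0.
have [c [v [nzv fv]]] := linear_eigenvector (comp_linr f) (simple_id_neq0 simX).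
exists c; apply/eqP; rewrite -subr_eq0; apply/negP => /negP nz.
have [g [gK _]] := schur kerA simX simX nz.
case/eqP: nzv; rewrite -[v]comp1m -gK -compA compBl fv compZl comp1m subrr.
exact: compm0.
Qed.

Definition brick_coef X (f : hom X X) : k := coord [tuple idm X] ord0 f.

Lemma brick_coef_lin X : scalar (@brick_coef X).
Proof. by move=> a f g; rewrite /brick_coef linearP. Qed.

Lemma brick_coefK X (f : hom X X) : brick X -> f = brick_coef f *: idm X.
Proof.
case=> nz /(_ f)[c ef].
have fin : f \in <<[tuple idm X]>>%VS.
  by rewrite span_seq1 ef memvZ ?memv_line.
by rewrite {1}(coord_span fin) big_ord1.
Qed.

(** Some entry of the matrix of [f] between simple summands is nonzero, hence invertible; [g] is the
    inverse of that entry, extended by zero. When an endomorphism ring is [k], this is what makes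
    nonzero maps split. *)
Lemma semisimple_regular X Y (f : hom X Y) :
  f != 0 -> exists g : hom Y X, f ∘ g ∘ f != 0.
Proof.
move=> nzf.
have [m [S [i [p [simS [_ _ ip]]]]]] := ssA X.
have [n [T [j [q [simT [_ _ jq]]]]]] := ssA Y.
have [/existsP[b /existsP[a nz]]|/existsPn none] :=
    boolP [exists b, [exists a, q b ∘ f ∘ i a != 0]].
  have [g [gK Kg]] := schur kerA (simS a) (simT b) nz.
  exists (i a ∘ g ∘ q b); apply: contra_neq nz => e.
  have /(congr1 (fun h => q b ∘ h ∘ i a)) := e.
  by rewrite compm0 comp0m !compA Kg comp1m.
case/eqP: nzf; rewrite -[f]comp1m -[idm Y ∘ f]compm1 -ip -jq comp_sumr.
apply: big1 => a _; rewrite compA comp_suml comp_suml big1 ?comp0m // => b _.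
have /existsPn/(_ a) := none b; rewrite negbK => /eqP.
by rewrite -!compA => ->; rewrite compm0.
Qed.

Lemma brick_section X Y (f : hom X Y) :
  brick Y -> f != 0 -> exists g, f ∘ g = idm Y.
Proof.
move=> [_ scal] /semisimple_regular[g]; have [c e] := scal (f ∘ g).
rewrite e compZl comp1m scaler_eq0 negb_or => /andP[nzc _].
by exists (c^-1 *: g); rewrite compZr e scalerA mulVf // scale1r.
Qed.

Lemma brick_retraction X Y (f : hom X Y) :
  brick X -> f != 0 -> exists g, g ∘ f = idm X.
Proof.
move=> [_ scal] /semisimple_regular[g]; have [c e] := scal (g ∘ f).
rewrite -compA e compZr compm1 scaler_eq0 negb_or => /andP[nzc _].
by exists (c^-1 *: g); rewrite compZl e scalerA mulVf // scale1r.
Qed.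

(** Composition into [End(X) = k] is a nondegenerate pairing, because every nonzero map out of a
    brick has a retraction. *)
Lemma brick_functional X Y (lam : hom X Y -> k) :
  brick X -> scalar lam -> exists u : hom Y X, forall v, u ∘ v = lam v *: idm X.
Proof.
move=> bX ll; pose b (u : hom Y X) (v : hom X Y) := brick_coef (u ∘ v).
have [||v b0|u bu] := @represent_functional _ _ _ b _ _ _ lam ll.
- by move=> v c f g; rewrite /b comp_linl brick_coef_lin.
- by move=> u c f g; rewrite /b comp_linr brick_coef_lin.
- apply/eqP/negP => /negP /(brick_retraction bX)[g gv].
  case: (bX) => /eqP[]; rewrite (brick_coefK (idm X) bX) -gv.
  by rewrite -/(b g v) b0 scale0r.
- by exists u => v; rewrite -bu [LHS]brick_coefK.
Qed.

Lemma dual_bases X Y : brick X -> exists (m : nat) (b : 'I_m -> hom X Y)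
    (d : 'I_m -> hom Y X),
  (forall f, exists c : 'I_m -> k, f = \sum_a c a *: b a) /\
  forall a a', d a ∘ b a' = (a == a')%:R *: idm X.
Proof.
move=> bX; pose e := vbasis {: hom X Y}.
have be : basis_of fullv e by apply: vbasisP.
have dual (a : 'I_(\dim {: hom X Y})) :
    {d : hom Y X | forall v, d ∘ v = coord e a v *: idm X}.
  by apply/constructive_indefinite_description/brick_functional => // c f g; rewrite linearP.
exists _, (fun a => e`_a), (fun a => proj1_sig (dual a)); split=> [f|a a'].
  by exists (fun a => coord e a f); rewrite -(coord_basis be (memvf f)).
rewrite (proj2_sig (dual a)) coord_free ?(eqxx, basis_free be) //.
by rewrite eq_sym.
Qed.

Lemma simple_transpose X Y : simple X -> simple Y ->
  exists2 t : hom X Y -> hom Y X, linear t & forall f, t f = 0 -> f = 0.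
Proof.
move=> simX simY; case: (excluded_middle_informative (exists f : hom X Y, f != 0)).
  move=> [f /(schur kerA simX simY)[g [gf fg]]].
  exists (fun h => g ∘ h ∘ g) => [c h h'|h e].
    by rewrite comp_linr comp_linl.
  by rewrite -[h]comp1m -fg -[_ ∘ _ ∘ h]compm1 -gf !compA -(compA f g) -(compA f) e compm0 comp0m.
move=> none; exists (fun=> 0) => [c h h'|h _]; first by rewrite scaler0 addr0.
by apply/eqP/negP => /negP nz; apply: none; exists h.
Qed.

(** Applied in both directions it gives equal dimensions of [Hom(X, Y)] and [Hom(Y, X)] without
    counting multiplicities. The map acts entrywise on matrices between simple summands and depends
    on choices. *)
Lemma semisimple_transpose X Y :
  exists2 t : hom X Y -> hom Y X, linear t & forall f, t f = 0 -> f = 0.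
Proof.
have [m [S [i [p [simS [pi pi0 ip]]]]]] := ssA X.
have [n [T [j [q [simT [qj qj0 jq]]]]]] := ssA Y.
have st a b : {t : hom (S a) (T b) -> hom (T b) (S a) |
    linear t /\ forall f, t f = 0 -> f = 0}.
  apply: constructive_indefinite_description.
  by have [t] := simple_transpose (simS a) (simT b); exists t.
pose t (f : hom X Y) : hom Y X :=
  \sum_a \sum_b i a ∘ proj1_sig (st a b) (q b ∘ f ∘ i a) ∘ q b.
exists t => [c f g|f tf0].
  rewrite /t scaler_sumr -big_split; apply: eq_bigr => a _ /=.
  rewrite scaler_sumr -big_split; apply: eq_bigr => b _ /=.
  have [lt _] := proj2_sig (st a b).
  by rewrite comp_linr comp_linl lt comp_linr comp_linl.
rewrite -[f]comp1m -[idm Y ∘ f]compm1 -ip -jq comp_sumr big1 // => a _.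
rewrite compA comp_suml comp_suml big1 ?comp0m // => b _.
have [_ inj] := proj2_sig (st a b).
rewrite -!compA [q b ∘ _]compA (inj (q b ∘ f ∘ i a)) ?compm0 //.
have /(congr1 (fun h => p a ∘ h ∘ j b)) := tf0.
rewrite compm0 comp0m /t comp_sumr comp_suml (bigD1 a) //= [X in _ + X]big1 ?addr0.
  rewrite comp_sumr comp_suml (bigD1 b) //= [X in _ + X]big1 ?addr0 => [|b' nb].
    by rewrite !compA pi comp1m -compA qj compm1.
  by rewrite -!compA qj0 1?eq_sym // !compm0.
move=> a' na; rewrite comp_sumr comp_suml big1 // => b' _.
by rewrite !compA pi0 // !comp0m.
Qed.

(** Keeping only a resolution of the identity, without orthogonality of its terms, suffices for
    testing equality of morphisms and passes easily to duals. *)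
Definition generating n (S : 'I_n -> A) := forall X, exists m (j : 'I_m -> 'I_n)
  (i : forall a, hom (S (j a)) X) (p : forall a, hom X (S (j a))),
  \sum_a i a ∘ p a = idm X.

Lemma generating_ext n (S : 'I_n -> A) X Y (f g : hom X Y) : generating S ->
  (forall j (h : hom (S j) X), f ∘ h = g ∘ h) -> f = g.
Proof.
move=> /(_ X)[m [j [i [p ip]]]] fg; rewrite -[f]compm1 -[g]compm1 -ip !comp_sumr.
by apply: eq_bigr => a _; rewrite !compA fg.
Qed.

(** Tested on maps from the generators: on the span of the [b j], which is all of [Hom(S j, Y)], the
    terms of index [j] act as the identity, and the other terms vanish by orthogonality. *)
Lemma casimir n (S : 'I_n -> A) Y (m : 'I_n -> nat)
    (b : forall i, 'I_(m i) -> hom (S i) Y) (d : forall i, 'I_(m i) -> hom Y (S i)) :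
  generating S ->
  (forall i j (f : hom (S i) (S j)), i != j -> f = 0) ->
  (forall i f, exists c : 'I_(m i) -> k, f = \sum_a c a *: b i a) ->
  (forall i a a', d i a ∘ b i a' = (a == a')%:R *: idm (S i)) ->
  \sum_i \sum_a b i a ∘ d i a = idm Y.
Proof.
move=> genS orth spanb dualb; apply: (generating_ext genS) => j h.
have [c ->] := spanb j h; rewrite !comp_sumr; apply: eq_bigr => a _.
rewrite !compZr comp1m; congr (_ *: _).
rewrite comp_suml (bigD1 j) //= [X in _ + X]big1 ?addr0 => [|i ni].
  rewrite comp_suml (bigD1 a) //= [X in _ + X]big1 ?addr0 => [|a' na].
    by rewrite -compA dualb eqxx scale1r compm1.
  by rewrite -compA dualb (negPf na) scale0r compm0.
rewrite comp_suml big1 // => a' _.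
by rewrite -compA [d i a' ∘ _]orth ?compm0 // eq_sym.
Qed.

Lemma semisimple_generating n (S : 'I_n -> A) :
  (forall X, simple X -> exists j, isomorphic X (S j)) -> generating S.
Proof.
move=> repS X; have [m [T [i [p [simT [_ _ ip]]]]]] := ssA X.
have rep a : {j & iso (T a) (S j)}.
  have /constructive_indefinite_description[j e] := repS _ (simT a).
  by exists j; apply: (epsilon e (fun=> True)).
exists m, (fun a => projT1 (rep a)), (fun a => i a ∘ bwd (projT2 (rep a))),
  (fun a => fwd (projT2 (rep a)) ∘ p a).
rewrite -ip; apply: eq_bigr => a _.
by rewrite !compA -(compA (i a)) fwdK compm1.
Qed.

End SemisimpleCategories.

(** * Dualities acting on bimodule categories *)

(* Locked, since [compA] and [bmapM] would otherwise see through them. *)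
HB.lock Definition evL (k : fieldType) (C : moncat k) (M : bimodcat C) (X' X : C)
    (d : duality X' X) (m : M) : hom (X' ▷ (X ▷ m)) m :=
  fwd (lone m) ∘ (ev d ▷m idm m) ∘ bwd (lassoc X' X m).
HB.lock Definition coevL (k : fieldType) (C : moncat k) (M : bimodcat C) (X' X : C)
    (d : duality X' X) (m : M) : hom m (X ▷ (X' ▷ m)) :=
  fwd (lassoc X X' m) ∘ (coev d ▷m idm m) ∘ bwd (lone m).
HB.lock Definition evR (k : fieldType) (C : moncat k) (M : bimodcat C) (X' X : C)
    (d : duality X' X) (m : M) : hom ((m ◁ X') ◁ X) m :=
  fwd (rone m) ∘ (idm m ◁m ev d) ∘ fwd (rassoc m X' X).
HB.lock Definition coevR (k : fieldType) (C : moncat k) (M : bimodcat C) (X' X : C)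
    (d : duality X' X) (m : M) : hom m ((m ◁ X) ◁ X') :=
  bwd (rassoc m X X') ∘ (idm m ◁m coev d) ∘ bwd (rone m).

Section DualityActions.
Context (k : fieldType) (C : moncat k) (M : bimodcat C).
Implicit Types (X Y Z : C) (m n : M).

Lemma lact_bwdK Y Z (i : iso Y Z) m :
  (fwd i ▷m idm m) ∘ (bwd i ▷m idm m) = idm _.
Proof. by rewrite -bmapM bwdK comp1m bmap1. Qed.

Lemma ract_fwdK m Y Z (i : iso Y Z) :
  (idm m ◁m bwd i) ∘ (idm m ◁m fwd i) = idm _.
Proof. by rewrite -bmapM fwdK comp1m bmap1. Qed.

Lemma unit_act_inj m n (f g : hom m n) :
  idm munit ▷m f = idm munit ▷m g -> f = g.
Proof.
move=> e; apply: (fwd_iso_inj (i := lone m)).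
by rewrite -!lone_nat e.
Qed.

Lemma act_unit_inj m n (f g : hom m n) :
  f ◁m idm munit = g ◁m idm munit -> f = g.
Proof.
move=> e; apply: (fwd_iso_inj (i := rone m)).
by rewrite -!rone_nat e.
Qed.

(* Kelly: the remaining unit coherences follow from pentagon and triangle. *)
Lemma lone_lassoc X m :
  fwd (lone (X ▷ m)) ∘ fwd (lassoc munit X m) = fwd (lunit X) ▷m idm m.
Proof.
apply: unit_act_inj; apply: (fwd_iso_inj (i := lassoc munit (munit ⊗ X) m)).
apply: (fwd_iso_inj (i := iso_bmap lact (assoc munit munit X) (iso_id m))) => /=.
rewrite bmapMr (post31 _ (esym (lassoc_pentagon _ _ _ _))).
rewrite compA lone_triangle -(bmap1 lact) -lassoc_nat.
by rewrite -lassoc_nat -triangle bmapMl compA.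
Qed.

Lemma rone_rassoc m X :
  (idm m ◁m fwd (runit X)) ∘ fwd (rassoc m X munit) = fwd (rone (m ◁ X)).
Proof.
apply: act_unit_inj; apply: (iso_fwd_inj (i := rassoc m X munit)).
rewrite -[in RHS]rone_triangle bmapMl !compA rassoc_nat.
rewrite -[in RHS](bmap1 ract) rassoc_nat (post22 _ (rassoc_pentagon _ _ _ _)).
by rewrite -triangle bmapMr !compA.
Qed.

Section Families.
Context (X' X : C) (d : duality X' X).

Lemma evL_nat m n (f : hom m n) :
  evL d n ∘ (idm X' ▷m (idm X ▷m f)) = f ∘ evL d m.
Proof.
rewrite evL.unlock -(post22 _ (iso_conj (lassoc_nat (idm X') (idm X) f))).
rewrite bmap1 (post21 _ (bmap_lr _ _ _)) -(bmap_rl _ (ev d)) !compA.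
by rewrite lone_nat.
Qed.

Lemma coevL_nat m n (f : hom m n) :
  coevL d n ∘ f = (idm X ▷m (idm X' ▷m f)) ∘ coevL d m.
Proof.
rewrite coevL.unlock !compA -lassoc_nat -(post22 _ (iso_conj (lone_nat f))).
by rewrite bmap1 !(post21 _ (bmap_lr _ _ _)) (post21 _ (bmap_rl _ _ _)).
Qed.

Lemma evR_nat m n (f : hom m n) :
  evR d n ∘ ((f ◁m idm X') ◁m idm X) = f ∘ evR d m.
Proof.
rewrite evR.unlock (post22 _ (rassoc_nat f (idm X') (idm X))).
rewrite bmap1 (post21 _ (bmap_rl _ _ _)) -(bmap_lr _ f (ev d)) !compA.
by rewrite rone_nat.
Qed.

Lemma coevR_nat m n (f : hom m n) :
  coevR d n ∘ f = ((f ◁m idm X) ◁m idm X') ∘ coevR d m.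
Proof.
rewrite coevR.unlock !compA (iso_conj (rassoc_nat f (idm X) (idm X'))).
rewrite -(post22 _ (iso_conj (rone_nat f))).
by rewrite bmap1 !(post21 _ (bmap_rl _ _ _)) (post21 _ (bmap_lr _ _ _)).
Qed.

(** [evL] and [coevL] are counit and unit of an adjunction with left adjoint [X' ▷ -] and right
    adjoint [X ▷ -]. The triangle identities reduce to those of the duality once the module
    associators are traded for [assoc] ([e1]) and the module unit constraints for those of [C]
    ([e2]). *)
Lemma zigL m : (idm X ▷m evL d m) ∘ coevL d (X ▷ m) = idm (X ▷ m).
Proof.
rewrite evL.unlock coevL.unlock !bmapMr !compA.
have e1 : (idm X ▷m bwd (lassoc X' X m)) ∘ fwd (lassoc X X' (X ▷ m)) =
    fwd (lassoc X (X' ⊗ X) m) ∘ (fwd (assoc X X' X) ▷m idm m)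
      ∘ bwd (lassoc (X ⊗ X') X m).
  apply: (fwd_iso_inj (i := lassoc (X ⊗ X') X m)).
  rewrite -(compA _ (bwd _)) fwdK compm1 -compA lassoc_pentagon !compA.
  by rewrite -bmapMr fwdK bmap1 comp1m.
rewrite (post22 _ e1) !compA (post22 _ (esym (lassoc_nat _ _ _))).
rewrite lone_triangle.
rewrite -(bmap1 lact) -(post22 _ (iso_conj (lassoc_nat _ _ _))).
have e2 : bwd (lassoc munit X m) ∘ bwd (lone (X ▷ m)) = bwd (lunit X) ▷m idm m.
  apply: (iso_fwd_inj (i := iso_comp (lone (X ▷ m)) (lassoc munit X m))) => /=.
  rewrite [in RHS]lone_lassoc -bmapMl bwdK bmap1 -compA (compA _ (bwd _)).
  by rewrite bwdK comp1m bwdK.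
by rewrite (post21 _ e2) -!bmapMl duality_zig bmap1.
Qed.

Lemma zagL m : evL d (X' ▷ m) ∘ (idm X' ▷m coevL d m) = idm (X' ▷ m).
Proof.
rewrite evL.unlock coevL.unlock !bmapMr !compA.
have e1 : bwd (lassoc X' X (X' ▷ m)) ∘ (idm X' ▷m fwd (lassoc X X' m)) =
    fwd (lassoc (X' ⊗ X) X' m) ∘ (bwd (assoc X' X X') ▷m idm m)
      ∘ bwd (lassoc X' (X ⊗ X') m).
  apply: (iso_fwd_inj (i := lassoc X' X (X' ▷ m))).
  rewrite !compA bwdK comp1m lassoc_pentagon (post21 _ (lact_bwdK (assoc X' X X') m)).
  by rewrite compm1 -compA bwdK compm1.
rewrite (post22 _ e1) !compA (post22 _ (esym (iso_conj (lassoc_nat _ _ _)))).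
have e2 : bwd (lassoc X' munit m) ∘ (idm X' ▷m bwd (lone m)) =
    bwd (runit X') ▷m idm m.
  apply: (iso_fwd_inj (i := iso_comp (iso_bmap lact (iso_id X') (lone m))
                               (lassoc X' munit m))) => /=.
  rewrite [in RHS]lone_triangle -bmapMl bwdK bmap1 -compA (compA _ (bwd _)).
  by rewrite bwdK comp1m -bmapMr bwdK bmap1.
rewrite (post21 _ e2) -(compA (fwd (lone _))) -(bmap1 lact).
rewrite -lassoc_nat compA lone_lassoc bmap1.
by rewrite -!bmapMl duality_zag bmap1.
Qed.

(** On the right the roles are exchanged: [- ◁ X] is left adjoint to [- ◁ X']. *)
Lemma zigR m : evR d (m ◁ X) ∘ (coevR d m ◁m idm X) = idm (m ◁ X).
Proof.
rewrite evR.unlock coevR.unlock !bmapMl !compA.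
have e1 : fwd (rassoc (m ◁ X) X' X) ∘ (bwd (rassoc m X X') ◁m idm X) =
    bwd (rassoc m X (X' ⊗ X)) ∘ (idm m ◁m fwd (assoc X X' X))
      ∘ fwd (rassoc m (X ⊗ X') X).
  apply: (iso_fwd_inj (i := rassoc m X (X' ⊗ X))).
  rewrite !compA bwdK comp1m rassoc_pentagon -(compA _ (_ ◁m _)) -bmapMl bwdK.
  by rewrite bmap1 compm1.
rewrite (post22 _ e1) !compA (post22 _ (rassoc_nat _ _ _)).
have e2 : fwd (rassoc m munit X) ∘ (bwd (rone m) ◁m idm X) =
    idm m ◁m bwd (lunit X).
  apply: (iso_fwd_inj (i := iso_bmap ract (iso_id m) (lunit X))) => /=.
  by rewrite compA rone_triangle -bmapMl -bmapMr !bwdK !bmap1.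
rewrite (post21 _ e2) -rone_rassoc -(bmap1 ract).
rewrite (post22 _ (rassoc_nat _ _ _)) (post21 _ (bwdK _)) compm1.
by rewrite -!bmapMr duality_zig bmap1.
Qed.

Lemma zagR m : (evR d m ◁m idm X') ∘ coevR d (m ◁ X') = idm (m ◁ X').
Proof.
rewrite evR.unlock coevR.unlock !bmapMl !compA.
have e1 : (fwd (rassoc m X' X) ◁m idm X') ∘ bwd (rassoc (m ◁ X') X X') =
    bwd (rassoc m (X' ⊗ X) X') ∘ (idm m ◁m bwd (assoc X' X X'))
      ∘ fwd (rassoc m X' (X ⊗ X')).
  apply: (fwd_iso_inj (i := rassoc (m ◁ X') X X')).
  rewrite -(compA _ (bwd _)) fwdK compm1 -compA rassoc_pentagon !compA.
  by rewrite (post21 _ (ract_fwdK m (assoc X' X X'))) compm1 fwdK comp1m.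
rewrite (post22 _ e1) !compA (post22 _ (iso_conj (rassoc_nat _ _ _))).
have e2 : (fwd (rone m) ◁m idm X') ∘ bwd (rassoc m munit X') =
    idm m ◁m fwd (lunit X').
  by rewrite -rone_triangle -compA bwdK compm1.
rewrite e2.
have e3 : fwd (rassoc m X' munit) ∘ bwd (rone (m ◁ X')) = idm m ◁m bwd (runit X').
  apply: (iso_fwd_inj (i := iso_bmap ract (iso_id m) (runit X'))) => /=.
  by rewrite compA rone_rassoc bwdK -bmapMr bwdK bmap1.
rewrite -[idm (m ◁ X')](bmap1 ract) (post22 _ (rassoc_nat _ _ _)).
by rewrite (post21 _ e3) -!bmapMr duality_zag bmap1.
Qed.

End Families.
End DualityActions.

(** * Module functors preserve evaluations and coevaluations *)

Section FunctorsAndDuality.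
Context (k : fieldType) (C : moncat k) (N M : bimodcat C) (X' X : C).
Context (d : duality X' X).

Section Left.
Context (G : linfunctor N M) (s : forall Y n, iso (Y ▷ G n) (G (Y ▷ n))).
Hypothesis s_nat : forall Y Y' n n' (f : hom Y Y') (h : hom n n'),
  fwd (s Y' n') ∘ (f ▷m fmap G h) = fmap G (f ▷m h) ∘ fwd (s Y n).
Hypothesis sA : forall Y Z n, fmap G (fwd (lassoc Y Z n)) ∘ fwd (s (Y ⊗ Z) n) =
  fwd (s Y (Z ▷ n)) ∘ (idm Y ▷m fwd (s Z n)) ∘ fwd (lassoc Y Z (G n)).
Hypothesis s1 : forall n, fmap G (fwd (lone n)) ∘ fwd (s munit n) = fwd (lone (G n)).

(** The strength is passed by itself, not inside a [bimodfunctor], so that functors compatible with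
    one action only are covered, such as [- ⊗ W] in [levC_tens]. *)
Lemma fmap_evL n :
  fmap G (evL d n) ∘ fwd (s X' (X ▷ n)) ∘ (idm X' ▷m fwd (s X n)) = evL d (G n).
Proof.
apply: (fwd_iso_inj (i := lassoc X' X (G n))).
rewrite -!compA (compA (fwd (s _ _))) -sA evL.unlock !fmapM !compA.
rewrite (post21 _ (fwdK (iso_fmap G (lassoc X' X n)))) compm1.
rewrite -(post22 _ (s_nat _ _)) fmap1 s1.
by rewrite -(compA _ (bwd _)) fwdK compm1.
Qed.

Lemma fmap_coevL n :
  fmap G (coevL d n) = fwd (s X (X' ▷ n)) ∘ (idm X ▷m fwd (s X' n)) ∘ coevL d (G n).
Proof.
rewrite coevL.unlock !compA -sA !fmapM -!compA; congr (_ ∘ _).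
apply: (fwd_iso_inj (i := iso_comp (iso_fmap G (lone n)) (s munit n))) => /=.
rewrite {2}s1 -!compA fwdK compm1 (compA (fmap G (bwd _))) -fmapM fwdK fmap1.
by rewrite comp1m -s_nat fmap1.
Qed.

End Left.

Section Right.
Context (G : linfunctor N M) (s : forall n Y, iso (G n ◁ Y) (G (n ◁ Y))).
Hypothesis s_nat : forall n n' Y Y' (h : hom n n') (f : hom Y Y'),
  fwd (s n' Y') ∘ (fmap G h ◁m f) = fmap G (h ◁m f) ∘ fwd (s n Y).
Hypothesis sA : forall n Y Z, fmap G (fwd (rassoc n Y Z)) ∘ fwd (s (n ◁ Y) Z)
    ∘ (fwd (s n Y) ◁m idm Z) = fwd (s n (Y ⊗ Z)) ∘ fwd (rassoc (G n) Y Z).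
Hypothesis s1 : forall n, fmap G (fwd (rone n)) ∘ fwd (s n munit) = fwd (rone (G n)).

Lemma fmap_evR n :
  fmap G (evR d n) ∘ fwd (s (n ◁ X') X) ∘ (fwd (s n X') ◁m idm X) = evR d (G n).
Proof.
rewrite evR.unlock !fmapM (post31 _ (sA _ _ _)) !compA.
by rewrite -(post22 _ (s_nat _ _)) fmap1 s1.
Qed.

Lemma fmap_coevR n :
  fmap G (coevR d n) = fwd (s (n ◁ X) X') ∘ (fwd (s n X) ◁m idm X') ∘ coevR d (G n).
Proof.
rewrite coevR.unlock; apply: (iso_fwd_inj (i := iso_fmap G (rassoc n X X'))) => /=.
rewrite !compA sA (post21 _ (bwdK _)) compm1 !fmapM !compA -fmapM bwdK fmap1.
rewrite comp1m -[idm (G n)](fmap1 G) s_nat -compA; congr (_ ∘ _).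
apply: (fwd_iso_inj (i := rone (G n))).
by rewrite -compA fwdK compm1 -s1 compA -fmapM fwdK fmap1 comp1m.
Qed.

End Right.
End FunctorsAndDuality.

Section RegularAction.
Context (k : fieldType) (C : moncat k).
Implicit Types (X Y Z T W : C).

Lemma lunit_assoc X Y :
  fwd (lunit (X ⊗ Y)) ∘ fwd (assoc munit X Y) = fwd (lunit X) ⊗m idm Y.
Proof. exact: (@lone_lassoc k C (regular_bimod C)). Qed.

Lemma runit_assoc X Y :
  (idm X ⊗m fwd (runit Y)) ∘ fwd (assoc X Y munit) = fwd (runit (X ⊗ Y)).
Proof. exact: (@rone_rassoc k C (regular_bimod C)). Qed.

Lemma lunit1_runit1 : fwd (lunit munit) = fwd (runit (munit : C)).
Proof.
apply: (act_unit_inj (M := regular_bimod C)) => /=.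
have e : fwd (lunit (munit ⊗ munit)) = idm munit ⊗m fwd (lunit (munit : C)).
  by apply: (iso_fwd_inj (i := lunit munit)); rewrite lunit_nat.
by rewrite -lunit_assoc e triangle.
Qed.

Section Families.
Context (X' X : C) (d : duality X' X).

Definition levC T : hom (X' ⊗ (X ⊗ T)) T := evL (M := regular_bimod C) d T.
Definition lcoevC T : hom T (X ⊗ (X' ⊗ T)) := coevL (M := regular_bimod C) d T.
Definition revC T : hom ((T ⊗ X') ⊗ X) T := evR (M := regular_bimod C) d T.
Definition rcoevC T : hom T ((T ⊗ X) ⊗ X') := coevR (M := regular_bimod C) d T.

Lemma levC_nat T T' (f : hom T T') :
  levC T' ∘ (idm X' ⊗m (idm X ⊗m f)) = f ∘ levC T.
Proof. exact: (evL_nat (M := regular_bimod C)). Qed.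

Lemma lcoevC_nat T T' (f : hom T T') :
  lcoevC T' ∘ f = (idm X ⊗m (idm X' ⊗m f)) ∘ lcoevC T.
Proof. exact: (coevL_nat (M := regular_bimod C)). Qed.

Lemma revC_nat T T' (f : hom T T') :
  revC T' ∘ ((f ⊗m idm X') ⊗m idm X) = f ∘ revC T.
Proof. exact: (evR_nat (M := regular_bimod C)). Qed.

Lemma rcoevC_nat T T' (f : hom T T') :
  rcoevC T' ∘ f = ((f ⊗m idm X) ⊗m idm X') ∘ rcoevC T.
Proof. exact: (coevR_nat (M := regular_bimod C)). Qed.

Lemma zigLC T : (idm X ⊗m levC T) ∘ lcoevC (X ⊗ T) = idm (X ⊗ T).
Proof. exact: (zigL (M := regular_bimod C)). Qed.

Lemma zagLC T : levC (X' ⊗ T) ∘ (idm X' ⊗m lcoevC T) = idm (X' ⊗ T).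
Proof. exact: (zagL (M := regular_bimod C)). Qed.

Lemma zigRC T : revC (T ⊗ X) ∘ (rcoevC T ⊗m idm X) = idm (T ⊗ X).
Proof. exact: (zigR (M := regular_bimod C)). Qed.

Lemma zagRC T : (revC T ⊗m idm X') ∘ rcoevC (T ⊗ X') = idm (T ⊗ X').
Proof. exact: (zagR (M := regular_bimod C)). Qed.

Let assocV_nat W Y Y' T T' (f : hom Y Y') (h : hom T T') :
  bwd (assoc Y' T' W) ∘ (f ⊗m (h ⊗m idm W)) =
  ((f ⊗m h) ⊗m idm W) ∘ bwd (assoc Y T W).
Proof. by rewrite (iso_conj (assoc_nat f h (idm W))). Qed.

Let assocV_pentagon W Y Z T :
  (fwd (assoc Y Z T) ⊗m idm W) ∘ bwd (assoc (Y ⊗ Z) T W) =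
  bwd (assoc Y (Z ⊗ T) W) ∘ (idm Y ⊗m bwd (assoc Z T W)) ∘ fwd (assoc Y Z (T ⊗ W)).
Proof.
apply: (fwd_iso_inj (i := assoc (Y ⊗ Z) T W)).
rewrite -[in RHS]compA pentagon -(compA _ (bwd _)) fwdK compm1.
rewrite !compA (post21 _ (fwdK (iso_bmap tens (iso_id Y) (assoc Z T W)))).
by rewrite compm1 fwdK comp1m.
Qed.

Let assocV_lunit W T :
  (fwd (lunit T) ⊗m idm W) ∘ bwd (assoc munit T W) = fwd (lunit (T ⊗ W)).
Proof. by rewrite -lunit_assoc -compA bwdK compm1. Qed.

(** The functor [- ⊗ W] is a left module functor through the inverse associator, so this is an
    instance of [fmap_evL]. *)
Lemma levC_tens T W :
  levC (T ⊗ W) ∘ (idm X' ⊗m fwd (assoc X T W)) ∘ fwd (assoc X' (X ⊗ T) W) =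
  levC T ⊗m idm W.
Proof.
have <- : (levC T ⊗m idm W) ∘ bwd (assoc X' (X ⊗ T) W)
    ∘ (idm X' ⊗m bwd (assoc X T W)) = levC (T ⊗ W) :=
  @fmap_evL k C (regular_bimod C) (regular_bimod C) X' X d (fun_r tens W)
  (fun Y n => iso_sym (assoc Y n W)) (@assocV_nat W) (@assocV_pentagon W)
  (@assocV_lunit W) T.
rewrite (post21 _ (fwdK (iso_bmap tens (iso_id X') (assoc X T W)))) compm1.
by rewrite -compA fwdK compm1.
Qed.

Lemma lcoevC_tens T W :
  fwd (assoc X (X' ⊗ T) W) ∘ (lcoevC T ⊗m idm W) =
  (idm X ⊗m bwd (assoc X' T W)) ∘ lcoevC (T ⊗ W).
Proof.
have -> : lcoevC T ⊗m idm W = bwd (assoc X (X' ⊗ T) W)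
    ∘ (idm X ⊗m bwd (assoc X' T W)) ∘ lcoevC (T ⊗ W) :=
  @fmap_coevL k C (regular_bimod C) (regular_bimod C) X' X d (fun_r tens W)
  (fun Y n => iso_sym (assoc Y n W)) (@assocV_nat W) (@assocV_pentagon W)
  (@assocV_lunit W) T.
by rewrite !compA bwdK comp1m.
Qed.

Lemma levCE T :
  levC T = fwd (lunit T) ∘ (ev d ⊗m idm T) ∘ bwd (assoc X' X T).
Proof. by rewrite /levC evL.unlock. Qed.

Lemma lcoevCE T :
  lcoevC T = fwd (assoc X X' T) ∘ (coev d ⊗m idm T) ∘ bwd (lunit T).
Proof. by rewrite /lcoevC coevL.unlock. Qed.

Lemma revCE T :
  revC T = fwd (runit T) ∘ (idm T ⊗m ev d) ∘ fwd (assoc T X' X).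
Proof. by rewrite /revC evR.unlock. Qed.

Lemma rcoevCE T :
  rcoevC T = bwd (assoc T X X') ∘ (idm T ⊗m coev d) ∘ bwd (runit T).
Proof. by rewrite /rcoevC coevR.unlock. Qed.

End Families.
End RegularAction.

Section FunctorsFromRegular.
Context (k : fieldType) (C : moncat k) (M : bimodcat C).
Context (F : bimodfunctor (regular_bimod C) M).
Implicit Types (X Y Z T : C).

(** Retypes [lstr] with [X ⊗ T] in place of the action of the regular bimodule, so that rewriting
    sees a tensor product. *)
Definition lF X T : iso (X ▷ F T) (F (X ⊗ T)) := lstr F X T.
Definition rF T X : iso (F T ◁ X) (F (T ⊗ X)) := rstr F T X.

Lemma lF_nat X X' T T' (f : hom X X') (h : hom T T') :
  fwd (lF X' T') ∘ (f ▷m fmap F h) = fmap F (f ⊗m h) ∘ fwd (lF X T).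
Proof. exact: (lstr_nat F). Qed.

Lemma rF_nat T T' X X' (h : hom T T') (f : hom X X') :
  fwd (rF T' X') ∘ (fmap F h ◁m f) = fmap F (h ⊗m f) ∘ fwd (rF T X).
Proof. exact: (rstr_nat F). Qed.

Lemma lFA X Y T : fmap F (fwd (assoc X Y T)) ∘ fwd (lF (X ⊗ Y) T) =
  fwd (lF X (Y ⊗ T)) ∘ (idm X ▷m fwd (lF Y T)) ∘ fwd (lassoc X Y (F T)).
Proof. exact: (lstrA F). Qed.

Lemma lF1 T : fmap F (fwd (lunit T)) ∘ fwd (lF munit T) = fwd (lone (F T)).
Proof. exact: (lstr1 F). Qed.

Lemma rFA T X Y :
  fmap F (fwd (assoc T X Y)) ∘ fwd (rF (T ⊗ X) Y) ∘ (fwd (rF T X) ◁m idm Y) =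
  fwd (rF T (X ⊗ Y)) ∘ fwd (rassoc (F T) X Y).
Proof. exact: (rstrA F). Qed.

Lemma rF1 T : fmap F (fwd (runit T)) ∘ fwd (rF T munit) = fwd (rone (F T)).
Proof. exact: (rstr1 F). Qed.

Lemma mFA X T Y :
  fmap F (fwd (assoc X T Y)) ∘ fwd (rF (X ⊗ T) Y) ∘ (fwd (lF X T) ◁m idm Y) =
  fwd (lF X (T ⊗ Y)) ∘ (idm X ▷m fwd (rF T Y)) ∘ fwd (massoc X (F T) Y).
Proof. exact: (mstrA F). Qed.

Section Duality.
Context (X' X : C) (d : duality X' X).

Lemma F_levC T :
  fmap F (levC d T) ∘ fwd (lF X' (X ⊗ T)) ∘ (idm X' ▷m fwd (lF X T)) = evL d (F T).
Proof. exact: (fmap_evL d (lstr_nat F) (lstrA F) (lstr1 F)). Qed.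

Lemma F_lcoevC T : fmap F (lcoevC d T) =
  fwd (lF X (X' ⊗ T)) ∘ (idm X ▷m fwd (lF X' T)) ∘ coevL d (F T).
Proof. exact: (fmap_coevL d (lstr_nat F) (lstrA F) (lstr1 F)). Qed.

Lemma F_revC T :
  fmap F (revC d T) ∘ fwd (rF (T ⊗ X') X) ∘ (fwd (rF T X') ◁m idm X) = evR d (F T).
Proof. exact: (fmap_evR d (rstr_nat F) (rstrA F) (rstr1 F)). Qed.

Lemma F_rcoevC T : fmap F (rcoevC d T) =
  fwd (rF (T ⊗ X) X') ∘ (fwd (rF T X) ◁m idm X') ∘ coevR d (F T).
Proof. exact: (fmap_coevR d (rstr_nat F) (rstrA F) (rstr1 F)). Qed.

End Duality.
End FunctorsFromRegular.

(** * Transposition along a duality *)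

Section Mates.
Context (k : fieldType) (C : moncat k) (X' X : C) (d : duality X' X).
Implicit Types (Y T W : C).

(** The transpositions [Hom(Y ⊗ X, 1) = Hom(Y, X')] and [Hom(X' ⊗ Y, 1) = Hom(Y, X)]: every map to
    the unit factors uniquely through the evaluation. *)
Definition lmate Y (q : hom (Y ⊗ X) munit) : hom Y X' :=
  fwd (lunit X') ∘ (q ⊗m idm X') ∘ rcoevC d Y.
Definition rmate Y (q : hom (X' ⊗ Y) munit) : hom Y X :=
  fwd (runit X) ∘ (idm X ⊗m q) ∘ lcoevC d Y.

Lemma ev_lmate Y (q : hom (Y ⊗ X) munit) : ev d ∘ (lmate q ⊗m idm X) = q.
Proof.
have e : ev d ∘ (fwd (lunit X') ⊗m idm X) = revC d munit.
  by rewrite revCE -lunit1_runit1 -lunit_assoc compA -lunit_nat.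
by rewrite /lmate !bmapMl !compA e revC_nat -compA zigRC compm1.
Qed.

Lemma lmate_ev Y (f : hom Y X') : lmate (ev d ∘ (f ⊗m idm X)) = f.
Proof.
rewrite /lmate bmapMl compA -(post22 _ (rcoevC_nat d f)).
by rewrite rcoevCE !compA duality_zag comp1m.
Qed.

Lemma ev_rmate Y (q : hom (X' ⊗ Y) munit) : ev d ∘ (idm X' ⊗m rmate q) = q.
Proof.
have e : ev d ∘ (idm X' ⊗m fwd (runit X)) = levC d munit.
  rewrite levCE lunit1_runit1 runit_nat -compA -runit_assoc.
  by rewrite -!compA bwdK compm1.
by rewrite /rmate !bmapMr !compA e levC_nat -compA zagLC compm1.
Qed.

Lemma ev_injl Y (f g : hom Y X') :
  ev d ∘ (f ⊗m idm X) = ev d ∘ (g ⊗m idm X) -> f = g.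
Proof. by move=> e; rewrite -[f]lmate_ev e lmate_ev. Qed.

End Mates.

(** * The right adjoint *)

Section UniversalArrow.
Context (k : fieldType) (A B : lincat k) (F : linfunctor A B).

(** A terminal object of the comma category of [F] over [d]; the right adjoint is assembled
    pointwise from such arrows. *)
Definition universal_arrow d r (e : hom (F r) d) :=
  (forall T (u : hom (F T) d), exists v : hom T r, e ∘ fmap F v = u) /\
  (forall T (v w : hom T r), e ∘ fmap F v = e ∘ fmap F w -> v = w).

End UniversalArrow.

Section UniversalArrowExistence.
Context (k : closedFieldType) (A B : lincat k) (F : linfunctor A B).
Context (n : nat) (S : 'I_n -> A).
Hypothesis abA : abelian A.
Hypothesis genS : generating S.
Hypothesis brickS : forall j, brick (S j).
Hypothesis orthS : forall i j (f : hom (S i) (S j)), i != j -> f = 0.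

(* Greedy construction: a simple summand is added for a morphism only when the
   morphism does not factor yet, which keeps the arrow injective. *)
Lemma universal_arrow_exists d : exists r (e : hom (F r) d), universal_arrow e.
Proof.
pose I := {j : 'I_n & 'I_(\dim {: hom (F (S j)) d})}.
pose tg j (a : 'I_(\dim {: hom (F (S j)) d})) : I := existT _ j a.
pose b (x : I) : hom (F (S (tag x))) d := (vbasis {: hom (F (S (tag x))) d})`_(tagged x).
have [r [e [inj fac]]] : exists r (e : hom (F r) d),
    (forall T (v : hom T r), e ∘ fmap F v = 0 -> v = 0) /\
    forall x : I, x \in enum {: I} -> exists v, e ∘ fmap F v = b x.
  elim: (enum _) => [|[j a] l [r [e [inj fac]]]].
    have [Z zZ] := ab_zero abA; exists Z, 0; split=> // T v _.
    by rewrite -[v]comp1m zZ comp0m.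
  case: (excluded_middle_informative (exists v, e ∘ fmap F v = b (tg j a))).
    move=> fx; exists r, e; split=> // x; rewrite inE => /orP[/eqP->|/fac] //.
  move=> nfx; have [r' [i1 [i2 [p1 [p2 [pi1 pi2 p2i1 p1i2 ip]]]]]] := ab_biprod abA (S j) r.
  pose e' := b (tg j a) ∘ fmap F p1 + e ∘ fmap F p2.
  exists r', e'; split=> [T v ev0|x].
    apply: (generating_ext genS) => l' h; rewrite comp0m.
    have : e' ∘ fmap F (v ∘ h) = 0 by rewrite fmapM compA ev0 comp0m.
    set w := v ∘ h; rewrite compDl -!compA -!fmapM => ew0.
    have p1w : p1 ∘ w = 0.
      have [el|] := eqVneq l' j; last exact: orthS.
      subst l'; have [_ /(_ (p1 ∘ w))[c ec]] := brickS j.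
      have [c0|nc] := eqVneq c 0; first by rewrite ec c0 scale0r.
      (* A nonzero component in the new summand could be solved for, and the new morphism would then
         factor through [e]. *)
      case: nfx; exists (- c^-1 *: (p2 ∘ w)).
      move: ew0; rewrite ec fmapZ fmap1 compZr compm1 addrC => /eqP.
      rewrite addr_eq0 => /eqP e2; rewrite fmapZ compZr e2 scalerN scaleNr opprK.
      by rewrite scalerA mulVf // scale1r.
    move: ew0; rewrite p1w fmap0 compm0 add0r => /inj p2w.
    by rewrite -[w]comp1m -ip compDl -!compA p1w p2w !compm0 addr0.
  rewrite inE => /orP[/eqP->|/fac[v ev]].
    exists i1; rewrite compDl -!compA -!fmapM pi1 p2i1 fmap1 fmap0 compm1 compm0.
    exact: addr0.
  exists (i2 ∘ v); rewrite compDl -!compA -!fmapM !compA pi2 p1i2 comp0m comp1m.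
  by rewrite fmap0 compm0 add0r.
exists r, e; split=> [T u|T v w vw]; last first.
  apply/eqP; rewrite -subr_eq0; apply/eqP/inj.
  by rewrite -scaleN1r fmapD fmapZ compDr compZr vw scaleN1r subrr.
have facS j (f : hom (F (S j)) d) : exists v, e ∘ fmap F v = f.
  have cb := coord_basis (vbasisP {: hom (F (S j)) d}) (memvf f).
  have fb a : {v : hom (S j) r | e ∘ fmap F v = b (tg j a)}.
    by apply: constructive_indefinite_description; apply: (fac (tg j a)); rewrite mem_enum.
  exists (\sum_a coord (vbasis {: hom (F (S j)) d}) a f *: proj1_sig (fb a)).
  rewrite [RHS]cb fmap_sum comp_sumr; apply: eq_bigr => a _.
  by rewrite fmapZ compZr (proj2_sig (fb a)).
have [m [j [i [p ip]]]] := genS T.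
have fi a : {v | e ∘ fmap F v = u ∘ fmap F (i a)}.
  exact/constructive_indefinite_description/facS.
exists (\sum_a proj1_sig (fi a) ∘ p a).
rewrite -[RHS]compm1 -fmap1 -ip !fmap_sum !comp_sumr; apply: eq_bigr => a _.
by rewrite !fmapM !compA (proj2_sig (fi a)).
Qed.

End UniversalArrowExistence.

Section RightAdjoint.
Context (k : fieldType) (C : moncat k) (M : bimodcat C) (rigC : rigid C).
Context (F : bimodfunctor (regular_bimod C) M).
Context (R0 : M -> C) (e : forall d, hom (F (R0 d)) d).
Hypothesis univ : forall d, universal_arrow (F := F) (e d).
Implicit Types (X Y T : C) (c d m : M).

Lemma fac_sig d T (u : hom (F T) d) : {v : hom T (R0 d) | e d ∘ fmap F v = u}.
Proof. exact/constructive_indefinite_description/(univ d).1. Qed.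

Definition fac d T (u : hom (F T) d) : hom T (R0 d) := proj1_sig (fac_sig u).

Lemma facE d T (u : hom (F T) d) : e d ∘ fmap F (fac u) = u.
Proof. exact: (proj2_sig (fac_sig u)). Qed.

Lemma fac_inj d T (v w : hom T (R0 d)) :
  e d ∘ fmap F v = e d ∘ fmap F w -> v = w.
Proof. exact: (univ d).2. Qed.

Definition Rmap d d' (f : hom d d') : hom (R0 d) (R0 d') := fac (f ∘ e d).

Lemma RmapE d d' (f : hom d d') : e d' ∘ fmap F (Rmap f) = f ∘ e d.
Proof. exact: facE. Qed.

Definition Rlin : linfunctor M C.
Proof.
exists R0 Rmap.
- by move=> d; apply: fac_inj; rewrite RmapE fmap1 comp1m compm1.
- by move=> d d' d'' g f; apply: fac_inj; rewrite fmapM compA !RmapE -!compA RmapE.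
- move=> d d' a f g; apply: fac_inj.
  by rewrite fmap_lin comp_linr !RmapE comp_linl.
Defined.

Lemma lFV_nat X X' T T' (f : hom X X') (h : hom T T') :
  bwd (lF F X' T') ∘ fmap F (f ⊗m h) = (f ▷m fmap F h) ∘ bwd (lF F X T).
Proof. by rewrite (iso_conj (lF_nat F f h)). Qed.

Lemma rFV_nat T T' X X' (h : hom T T') (f : hom X X') :
  bwd (rF F T' X') ∘ fmap F (h ⊗m f) = (fmap F h ◁m f) ∘ bwd (rF F T X).
Proof. by rewrite (iso_conj (rF_nat F h f)). Qed.

Lemma lFVA X Y T :
  (idm X ▷m bwd (lF F Y T)) ∘ bwd (lF F X (Y ⊗ T)) ∘ fmap F (fwd (assoc X Y T)) =
  fwd (lassoc X Y (F T)) ∘ bwd (lF F (X ⊗ Y) T).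
Proof.
apply: (fwd_iso_inj (i := lF F (X ⊗ Y) T)).
rewrite (post21 _ (lFA F X Y T)) !compA (post21 _ (fwdK _)) compm1.
rewrite -bmapMr fwdK bmap1 comp1m.
by rewrite -compA fwdK compm1.
Qed.

Lemma rFVA T X Y :
  bwd (rF F T (X ⊗ Y)) ∘ fmap F (fwd (assoc T X Y)) =
  fwd (rassoc (F T) X Y) ∘ (bwd (rF F T X) ◁m idm Y) ∘ bwd (rF F (T ⊗ X) Y).
Proof.
apply: (fwd_iso_inj (i := rF F (T ⊗ X) Y)).
apply: (fwd_iso_inj (i := iso_bmap ract (rF F T X) (iso_id Y))) => /=.
rewrite -(compA (bwd _)) -(compA (bwd _)) rFA compA fwdK comp1m.
by rewrite (post21 _ (fwdK _)) compm1 -compA -bmapMl fwdK bmap1 compm1.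
Qed.

Lemma mFVA X T Y :
  (idm X ▷m bwd (rF F T Y)) ∘ bwd (lF F X (T ⊗ Y)) ∘ fmap F (fwd (assoc X T Y)) =
  fwd (massoc X (F T) Y) ∘ (bwd (lF F X T) ◁m idm Y) ∘ bwd (rF F (X ⊗ T) Y).
Proof.
apply: (fwd_iso_inj (i := rF F (X ⊗ T) Y)).
apply: (fwd_iso_inj (i := iso_bmap ract (lF F X T) (iso_id Y))) => /=.
rewrite (post31 _ (mFA F X T Y)) !compA (post21 _ (fwdK (lF F X (T ⊗ Y)))) compm1.
rewrite -bmapMr fwdK bmap1 comp1m.
by rewrite (post21 _ (fwdK _)) compm1 -compA -bmapMl fwdK bmap1 compm1.
Qed.

Lemma lF1V T : fmap F (fwd (lunit T)) = fwd (lone (F T)) ∘ bwd (lF F munit T).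
Proof. by rewrite -lF1 -compA bwdK compm1. Qed.

Lemma rF1V T : fmap F (fwd (runit T)) = fwd (rone (F T)) ∘ bwd (rF F T munit).
Proof. by rewrite -rF1 -compA bwdK compm1. Qed.

Definition lR X d : hom (X ⊗ R0 d) (R0 (X ▷ d)) :=
  fac ((idm X ▷m e d) ∘ bwd (lF F X (R0 d))).
Definition rR d X : hom (R0 d ⊗ X) (R0 (d ◁ X)) :=
  fac ((e d ◁m idm X) ∘ bwd (rF F (R0 d) X)).

Lemma lRE X d : e _ ∘ fmap F (lR X d) = (idm X ▷m e d) ∘ bwd (lF F X (R0 d)).
Proof. exact: facE. Qed.
Lemma rRE d X : e _ ∘ fmap F (rR d X) = (e d ◁m idm X) ∘ bwd (rF F (R0 d) X).
Proof. exact: facE. Qed.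

(* The left dual of [X] turns morphisms [F T -> X ▷ d] into morphisms
   [F (X' ⊗ T) -> d], so [X ⊗ R0 d] is universal for [X ▷ d]. *)
Lemma lact_universal X d :
  universal_arrow (F := F) ((idm X ▷m e d) ∘ bwd (lF F X (R0 d))).
Proof.
have dX := ldualP rigC X; set X' := ldual rigC X in dX.
split=> [T u|T v w vw].
  pose u' : hom (F (X' ⊗ T)) d := evL dX d ∘ (idm X' ▷m u) ∘ bwd (lF F X' T).
  exists ((idm X ⊗m fac u') ∘ lcoevC dX T).
  rewrite fmapM F_lcoevC !compA (post22 _ (lFV_nat _ _)).
  rewrite (post21 _ (fwdK _)) compm1 -!bmapMr facE.
  rewrite -(compA _ (bwd _)) fwdK compm1 bmapMr.
  by rewrite -(post22 _ (coevL_nat _ _)) zigL comp1m.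
have retr (g : hom T (X ⊗ R0 d)) :
    (idm X ⊗m (levC dX (R0 d) ∘ (idm X' ⊗m g))) ∘ lcoevC dX T = g.
  by rewrite bmapMr -(post22 _ (lcoevC_nat _ _)) zigLC comp1m.
rewrite -[v]retr -[w]retr; congr (_ ∘ _).
congr (bmap _ _ _); apply: fac_inj.
have ev_e (g : hom T (X ⊗ R0 d)) :
    e d ∘ fmap F (levC dX (R0 d) ∘ (idm X' ⊗m g)) =
    evL dX d ∘ (idm X' ▷m ((idm X ▷m e d) ∘ bwd (lF F X (R0 d)) ∘ fmap F g))
      ∘ bwd (lF F X' T).
  rewrite !bmapMr !compA evL_nat -F_levC fmapM !compA.
  rewrite -(post22 _ (lFV_nat _ _)).
  rewrite (post21 _ (bwdK (iso_bmap lact (iso_id X') (lF F X (R0 d))))) compm1.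
  by rewrite (post21 _ (bwdK _)) compm1.
by rewrite !ev_e vw.
Qed.

Lemma ract_universal d X :
  universal_arrow (F := F) ((e d ◁m idm X) ∘ bwd (rF F (R0 d) X)).
Proof.
have dX := rdualP rigC X; set X' := rdual rigC X in dX.
split=> [T u|T v w vw].
  pose u' : hom (F (T ⊗ X')) d := evR dX d ∘ (u ◁m idm X') ∘ bwd (rF F T X').
  exists ((fac u' ⊗m idm X) ∘ rcoevC dX T).
  rewrite fmapM F_rcoevC !compA (post22 _ (rFV_nat _ _)).
  rewrite (post21 _ (fwdK _)) compm1 -!bmapMl facE.
  rewrite -(compA _ (bwd _)) fwdK compm1 bmapMl.
  by rewrite -(post22 _ (coevR_nat _ _)) zagR comp1m.
have retr (g : hom T (R0 d ⊗ X)) :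
    ((revC dX (R0 d) ∘ (g ⊗m idm X')) ⊗m idm X) ∘ rcoevC dX T = g.
  by rewrite bmapMl -(post22 _ (rcoevC_nat _ _)) zagRC comp1m.
rewrite -[v]retr -[w]retr; congr (_ ∘ _).
congr (bmap _ _ _); apply: fac_inj.
have ev_e (g : hom T (R0 d ⊗ X)) :
    e d ∘ fmap F (revC dX (R0 d) ∘ (g ⊗m idm X')) =
    evR dX d ∘ (((e d ◁m idm X) ∘ bwd (rF F (R0 d) X) ∘ fmap F g) ◁m idm X')
      ∘ bwd (rF F T X').
  rewrite !bmapMl !compA evR_nat -F_revC fmapM !compA.
  rewrite -(post22 _ (rFV_nat _ _)).
  rewrite (post21 _ (bwdK (iso_bmap ract (rF F (R0 d) X) (iso_id X')))) compm1.
  by rewrite (post21 _ (bwdK _)) compm1.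
by rewrite !ev_e vw.
Qed.

Lemma universal_iso d r (e' : hom (F r) d) (f : hom r (R0 d)) :
  universal_arrow (F := F) e' -> e d ∘ fmap F f = e' ->
  {i : iso r (R0 d) | fwd i = f}.
Proof.
move=> [ex inj] ef.
have [g eg] := constructive_indefinite_description _ (ex _ (e d)).
have gf : g ∘ f = idm r by apply: inj; rewrite fmapM compA eg ef fmap1 compm1.
have fg : f ∘ g = idm (R0 d).
  by apply: fac_inj; rewrite fmapM compA ef eg fmap1 compm1.
by exists (Iso gf fg).
Qed.

(** The right adjoint of a module functor is a priori only lax; rigidity enters through
    [lact_universal] and makes the comparison map [lR] invertible. *)
Definition lRiso X d : iso (X ⊗ R0 d) (R0 (X ▷ d)) :=
  proj1_sig (universal_iso (lact_universal X d) (lRE X d)).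
Definition rRiso d X : iso (R0 d ⊗ X) (R0 (d ◁ X)) :=
  proj1_sig (universal_iso (ract_universal d X) (rRE d X)).

Lemma fwd_lRiso X d : fwd (lRiso X d) = lR X d.
Proof. exact: (proj2_sig (universal_iso (lact_universal X d) (lRE X d))). Qed.
Lemma fwd_rRiso d X : fwd (rRiso d X) = rR d X.
Proof. exact: (proj2_sig (universal_iso (ract_universal d X) (rRE d X))). Qed.

(** Each axiom is an equality of maps into some [R0 d], so by [fac_inj] it can be checked after
    applying [F] and composing with [e], where it follows from the corresponding property of [F]. *)
Definition Rbimod : bimodfunctor M (regular_bimod C).
Proof.
refine (@BimodFunctor k C M (regular_bimod C) Rlin lRiso rRiso _ _ _ _ _ _ _) => /=.
- move=> X X' d d' f h; rewrite !fwd_lRiso; apply: fac_inj.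
  rewrite !fmapM !compA lRE RmapE -(post22 _ (esym (lFV_nat _ _))).
  by rewrite -bmapM RmapE comp1m -compA lRE compA -bmapM compm1.
- move=> d d' X X' h f; rewrite !fwd_rRiso; apply: fac_inj.
  rewrite !fmapM !compA rRE RmapE -(post22 _ (esym (rFV_nat _ _))).
  by rewrite -bmapM RmapE comp1m -compA rRE compA -bmapM compm1.
- move=> X Y d; rewrite !fwd_lRiso; apply: fac_inj.
  rewrite !fmapM !compA RmapE lRE -(compA (fwd _)) lRE.
  rewrite (post22 _ (lFV_nat _ _)) -bmapMr lRE bmapMr (post31 _ (lFVA _ _ _)).
  by rewrite !compA -lassoc_nat bmap1.
- move=> d; rewrite !fwd_lRiso; apply: fac_inj.
  by rewrite fmapM compA RmapE -compA lRE compA lone_nat lF1V compA.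
- move=> d X Y; rewrite !fwd_rRiso; apply: fac_inj.
  rewrite !fmapM !compA RmapE -(compA (fwd _)) rRE compA.
  rewrite (post22 _ (rFV_nat _ _)) -(compA (fwd _)) -bmapMl rRE bmapMl.
  by rewrite !compA rassoc_nat rRE bmap1 -[RHS]compA rFVA !compA.
- move=> d; rewrite !fwd_rRiso; apply: fac_inj.
  by rewrite fmapM compA RmapE -compA rRE compA rone_nat rF1V compA.
- move=> X d Y; rewrite !fwd_rRiso !fwd_lRiso; apply: fac_inj.
  rewrite !fmapM !compA RmapE -(compA (fwd _)) rRE compA.
  rewrite (post22 _ (rFV_nat _ _)) -(compA (fwd _)) -bmapMl lRE bmapMl.
  rewrite !compA massoc_nat lRE (post22 _ (lFV_nat _ _)) -bmapMr rRE bmapMr.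
  by rewrite (post31 _ (mFVA _ _ _)) !compA.
Defined.

Definition Runit : bimodtrans (idbimod (regular_bimod C)) (compbimod Rbimod F).
Proof.
refine (@BimodTrans k C (regular_bimod C) (regular_bimod C)
  (idbimod (regular_bimod C)) (compbimod Rbimod F)
  (fun T => fac (idm (F T))) _ _ _) => /=.
- move=> T T' h; apply: fac_inj.
  by rewrite !fmapM !compA RmapE facE -compA facE comp1m compm1.
- move=> X T; rewrite fwd_lRiso compm1; apply: fac_inj.
  rewrite !fmapM !compA RmapE facE -(compA (fwd _)) lRE.
  rewrite !compA -(compA _ (bwd _)) lFV_nat compA -(compA (fwd _)) -bmapMr facE.
  by rewrite bmap1 compm1 bwdK.
- move=> T X; rewrite fwd_rRiso compm1; apply: fac_inj.
  rewrite !fmapM !compA RmapE facE -(compA (fwd _)) rRE.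
  rewrite !compA -(compA _ (bwd _)) rFV_nat compA -(compA (fwd _)) -bmapMl facE.
  by rewrite bmap1 compm1 bwdK.
Defined.

Definition Rcounit : bimodtrans (compbimod F Rbimod) (idbimod M).
Proof.
refine (@BimodTrans k C M M (compbimod F Rbimod) (idbimod M) e _ _ _) => /=.
- by move=> d d' h; rewrite RmapE.
- move=> X d; rewrite fwd_lRiso compA lRE -compA comp1m.
  by rewrite [bwd _ ∘ _](fwdK (lF F X (R0 d))) compm1.
- move=> d X; rewrite fwd_rRiso compA rRE -compA comp1m.
  by rewrite [bwd _ ∘ _](fwdK (rF F (R0 d) X)) compm1.
Defined.

Lemma right_adjunction : bimod_adjunction F Rbimod.
Proof.
exists Runit Rcounit => [T|d] /=; first exact: facE.
by apply: fac_inj; rewrite fmapM compA RmapE -compA facE fmap1.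
Qed.

End RightAdjoint.

(** * Conditional expectations *)

(** The spaces [Hom(F T, F Y)] are the morphisms of the full image of [F], a category on the objects
    of [C]; [hL] and [hR] are the left and right actions of [C] on it. *)
HB.lock Definition hL (k : fieldType) (C : moncat k) (M : bimodcat C)
    (F : bimodfunctor (regular_bimod C) M) (X T Y : C) (h : hom (F T) (F Y)) :
  hom (F (X ⊗ T)) (F (X ⊗ Y)) := fwd (lF F X Y) ∘ (idm X ▷m h) ∘ bwd (lF F X T).
HB.lock Definition hR (k : fieldType) (C : moncat k) (M : bimodcat C)
    (F : bimodfunctor (regular_bimod C) M) (T Y : C) (h : hom (F T) (F Y)) (X : C) :
  hom (F (T ⊗ X)) (F (Y ⊗ X)) := fwd (rF F Y X) ∘ (h ◁m idm X) ∘ bwd (rF F T X).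

Section TensoringMorphisms.
Context (k : fieldType) (C : moncat k) (M : bimodcat C).
Context (F : bimodfunctor (regular_bimod C) M).
Implicit Types (X Y Z T : C).

Lemma hL_fmap X T Y (f : hom T Y) : hL X (fmap F f) = fmap F (idm X ⊗m f).
Proof. by rewrite hL.unlock lF_nat -compA bwdK compm1. Qed.

Lemma hR_fmap T Y X (f : hom T Y) : hR (fmap F f) X = fmap F (f ⊗m idm X).
Proof. by rewrite hR.unlock rF_nat -compA bwdK compm1. Qed.

Lemma hLM X T Y Z (g : hom (F Y) (F Z)) (h : hom (F T) (F Y)) :
  hL X (g ∘ h) = hL X g ∘ hL X h.
Proof. by rewrite hL.unlock bmapMr !compA (post21 _ (fwdK _)) compm1. Qed.

Lemma hRM X T Y Z (g : hom (F Y) (F Z)) (h : hom (F T) (F Y)) :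
  hR (g ∘ h) X = hR g X ∘ hR h X.
Proof. by rewrite hR.unlock bmapMl !compA (post21 _ (fwdK _)) compm1. Qed.

Lemma hL_lin X T Y : linear (@hL k C M F X T Y).
Proof. by move=> c f g; rewrite hL.unlock bmap_linr comp_linr comp_linl. Qed.

Lemma hR_lin T Y X : linear (fun h => @hR k C M F T Y h X).
Proof. by move=> c f g; rewrite hR.unlock bmap_linl comp_linr comp_linl. Qed.

Lemma hL_nat X X' T Y (f : hom X X') (h : hom (F T) (F Y)) :
  fmap F (f ⊗m idm Y) ∘ hL X h = hL X' h ∘ fmap F (f ⊗m idm T).
Proof.
rewrite hL.unlock -(compA _ (bwd _)) lFV_nat !compA -lF_nat !fmap1.
by rewrite (post21 _ (bmap_lr _ _ _)) (post21 _ (bmap_rl _ _ _)).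
Qed.

Lemma hR_nat X X' T Y (f : hom X X') (h : hom (F T) (F Y)) :
  fmap F (idm Y ⊗m f) ∘ hR h X = hR h X' ∘ fmap F (idm T ⊗m f).
Proof.
rewrite hR.unlock -(compA _ (bwd _)) rFV_nat !compA -rF_nat !fmap1.
by rewrite (post21 _ (bmap_lr _ _ _)) (post21 _ (bmap_rl _ _ _)).
Qed.

Lemma hL_assoc X X' T Y (h : hom (F T) (F Y)) :
  fmap F (fwd (assoc X X' Y)) ∘ hL (X ⊗ X') h =
  hL X (hL X' h) ∘ fmap F (fwd (assoc X X' T)).
Proof.
rewrite hL.unlock !bmapMr !compA lFA (post31 _ (lFVA _ _ _ _)) !compA -(bmap1 tens).
by rewrite (post22 _ (lassoc_nat _ _ _)).
Qed.

Lemma hR_assoc X X' T Y (h : hom (F T) (F Y)) :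
  fmap F (fwd (assoc Y X X')) ∘ hR (hR h X) X' =
  hR h (X ⊗ X') ∘ fmap F (fwd (assoc T X X')).
Proof.
rewrite hR.unlock -[RHS]compA rFVA !bmapMl !compA rFA -(bmap1 tens).
by rewrite (post22 _ (rassoc_nat _ _ _)).
Qed.

Lemma hLR X X' T Y (h : hom (F T) (F Y)) :
  fmap F (fwd (assoc X Y X')) ∘ hR (hL X h) X' =
  hL X (hR h X') ∘ fmap F (fwd (assoc X T X')).
Proof.
rewrite hR.unlock hL.unlock !bmapMl !bmapMr !compA mFA (post31 _ (mFVA _ _ _ _)) !compA.
by rewrite (post22 _ (massoc_nat _ _ _)).
Qed.

End TensoringMorphisms.

(** * The expectation compatible with the right action *)

Section Expectation.
Context (k : closedFieldType) (C : moncat k) (M : bimodcat C).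
Context (F : bimodfunctor (regular_bimod C) M).
Hypothesis kerC : has_kernels C.
Hypothesis ssC : semisimple C.
Hypothesis rigC : rigid C.
Hypothesis brick1 : brick (munit : C).
Hypothesis brickF1 : brick (F munit).
Implicit Types (X Y Z T : C).

Lemma fmap_unit_inj (f g : hom munit (munit : C)) : fmap F f = fmap F g -> f = g.
Proof.
case: brick1 => _ scal; have [c ->] := scal f; have [c' ->] := scal g.
rewrite !fmapZ fmap1 => /eqP; rewrite -subr_eq0 -scalerBl scaler_eq0.
by case: brickF1 => /negPf-> _; rewrite orbF subr_eq0 => /eqP->.
Qed.

(* [f] and [h] have the same matrix coefficients, read in [End(F 1) = End(1)]. *)
Definition expects T X (h : hom (F T) (F X)) (f : hom T X) :=
  forall Z (i : hom munit (T ⊗ Z)) (p : hom (X ⊗ Z) munit),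
    fmap F p ∘ hR h Z ∘ fmap F i = fmap F (p ∘ (f ⊗m idm Z) ∘ i).

(** A nonzero difference of [f] and [g] transposes to a nonzero map from [T] tensored with the right
    dual of [X] to the unit. Such a map splits, and its section gives a matrix coefficient that
    separates [f] from [g]. *)
Lemma expects_uniq T X (h : hom (F T) (F X)) (f g : hom T X) :
  expects h f -> expects h g -> f = g.
Proof.
move=> hf hg; have dX := rdualP rigC X.
apply/eqP; rewrite -subr_eq0; apply/negP => /negP nz.
have nz' : ev dX ∘ ((f - g) ⊗m idm (rdual rigC X)) != 0.
  apply: contra_neq nz => e; apply: (ev_injl (d := dX)).
  by rewrite e bmap0l compm0.
have [i ei] := brick_section kerC ssC brick1 nz'.
case: (brick1) => /eqP[]; rewrite -ei -scaleN1r bmapDl compDr compDl.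
rewrite bmapZl compZr compZl scaleN1r; apply/eqP; rewrite subr_eq0; apply/eqP.
by apply: fmap_unit_inj; rewrite -hf -hg.
Qed.

(** It suffices to match the coefficients whose [p] is the evaluation of [X]: they form a linear
    functional of [i], represented by some [q], and [f] is the transpose of [q]. Any other [p] is
    this evaluation after a map [Z' -> Z], along which [hR] is natural. *)
Lemma expects_exists T X (h : hom (F T) (F X)) : exists f, expects h f.
Proof.
have dX := rdualP rigC X; set Z := rdual rigC X in dX.
pose lam (i : hom munit (T ⊗ Z)) := brick_coef (fmap F (ev dX) ∘ hR h Z ∘ fmap F i).
have lamE i : fmap F (ev dX) ∘ hR h Z ∘ fmap F i = fmap F (lam i *: idm munit).
  by rewrite fmapZ fmap1 [LHS]brick_coefK.
have lin_lam : scalar lam.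
  by move=> c i j; rewrite /lam fmap_lin comp_linr brick_coef_lin.
have [q qE] := brick_functional kerC ssC brick1 lin_lam.
exists (lmate dX q) => Z' i p; rewrite -[p](ev_rmate dX).
rewrite fmapM (post22 _ (hR_nat _ _)) -(compA _ (fmap F _)) -fmapM lamE -qE.
by rewrite -{1}(ev_lmate dX q) compA (post21 _ (bmap_lr _ _ _)) (post21 _ (bmap_rl _ _ _)).
Qed.

Definition expect T X (h : hom (F T) (F X)) : hom T X :=
  proj1_sig (constructive_indefinite_description _ (expects_exists h)).

Lemma expectP T X (h : hom (F T) (F X)) : expects h (expect h).
Proof. exact: proj2_sig. Qed.

Lemma expectE T X (h : hom (F T) (F X)) f : expects h f -> expect h = f.
Proof. exact: expects_uniq (expectP h). Qed.

Lemma expect_nat T T' X X' (b : hom X X') (h : hom (F T) (F X)) (a : hom T' T) :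
  expect (fmap F b ∘ h ∘ fmap F a) = b ∘ expect h ∘ a.
Proof.
apply: expectE => Z i p; rewrite !hRM !hR_fmap !compA -fmapM.
by rewrite -(compA _ (fmap F _)) -fmapM expectP !bmapMl !compA.
Qed.

Lemma expect_fmap T X (f : hom T X) : expect (fmap F f) = f.
Proof. by apply: expectE => Z i p; rewrite hR_fmap !fmapM. Qed.

Lemma expect_lin T X : linear (@expect T X).
Proof.
move=> c f g; apply: expectE => Z i p; rewrite hR_lin comp_linr comp_linl !expectP.
by rewrite -fmap_lin bmap_linl comp_linr comp_linl.
Qed.

Lemma expect_hR T X (h : hom (F T) (F X)) Y : expect (hR h Y) = expect h ⊗m idm Y.
Proof.
apply: expectE => Z i p.
have e : hR (hR h Y) Z = fmap F (bwd (assoc X Y Z)) ∘ hR h (Y ⊗ Z)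
    ∘ fmap F (fwd (assoc T Y Z)).
  by rewrite -compA -hR_assoc compA -fmapM fwdK fmap1 comp1m.
rewrite e !compA -fmapM -(compA _ (fmap F _)) -fmapM expectP.
rewrite -(bmap1 tens) -!compA (compA (_ ⊗m (_ ⊗m _))); congr (fmap F (_ ∘ _)).
by rewrite !compA; congr (_ ∘ _); rewrite -compA -assoc_nat compA fwdK comp1m.
Qed.

End Expectation.

(** * Tensoring functors and their transformations as right module maps *)

HB.lock Definition tens_split (k : fieldType) (C : moncat k) (A B B' : C)
    (b : hom A (B ⊗ B')) (Z : C) : hom (A ⊗ Z) (B ⊗ (B' ⊗ Z)) :=
  fwd (assoc B B' Z) ∘ (b ⊗m idm Z).
HB.lock Definition tens_merge (k : fieldType) (C : moncat k) (A B B' : C)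
    (f : hom (B ⊗ B') A) (Z : C) : hom (B ⊗ (B' ⊗ Z)) (A ⊗ Z) :=
  (f ⊗m idm Z) ∘ bwd (assoc B B' Z).

Section RightModuleTransformations.
Context (k : fieldType) (C : moncat k).
Implicit Types (X Y Z T W A B : C).

(* An endofunctor of [C] with a strength for the right [C]-action; coherence of the
   strength is not imposed. *)
Record rmfun := RMFun {
  rmf :> linfunctor C C;
  rms : forall Z W, hom (rmf Z ⊗ W) (rmf (Z ⊗ W))
}.

Implicit Types P Q R : rmfun.

Definition rmid : rmfun := @RMFun (idfunctor C) (fun Z W => idm (Z ⊗ W)).
Definition rmtens X : rmfun := @RMFun (fun_l tens X) (fun Z W => fwd (assoc X Z W)).
Definition rmcomp (P Q : rmfun) : rmfun :=
  @RMFun (compfunctor P Q) (fun Z W => fmap P (rms Q Z W) ∘ rms P (Q Z) W).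

Definition rmtrans (P Q : rmfun) (t : forall Z, hom (P Z) (Q Z)) :=
  (forall Z Z' (f : hom Z Z'), t Z' ∘ fmap P f = fmap Q f ∘ t Z) /\
  (forall Z W, t (Z ⊗ W) ∘ rms P Z W = rms Q Z W ∘ (t Z ⊗m idm W)).

Lemma rmtrans_ext P Q (t t' : forall Z, hom (P Z) (Q Z)) :
  rmtrans t -> (forall Z, t Z = t' Z) -> rmtrans t'.
Proof. by move=> [nat str] e; split=> *; rewrite -!e. Qed.

Lemma rmtrans_id (P : rmfun) : rmtrans (P := P) (Q := P) (fun Z => idm (P Z)).
Proof. by split=> *; rewrite ?bmap1 comp1m compm1. Qed.

Lemma rmtrans_comp P Q R (t : forall Z, hom (P Z) (Q Z))
    (u : forall Z, hom (Q Z) (R Z)) :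
  rmtrans t -> rmtrans u -> rmtrans (P := P) (Q := R) (fun Z => u Z ∘ t Z).
Proof.
move=> [nt st] [nu su]; split=> [Z Z' f|Z W].
  by rewrite -compA nt compA nu compA.
by rewrite -compA st compA su bmapMl compA.
Qed.

Lemma rmtrans_l (R P Q : rmfun) (t : forall Z, hom (P Z) (Q Z)) :
  (forall Z Z' W (f : hom Z Z'),
     rms R Z' W ∘ (fmap R f ⊗m idm W) = fmap R (f ⊗m idm W) ∘ rms R Z W) ->
  rmtrans t ->
  rmtrans (P := rmcomp R P) (Q := rmcomp R Q) (fun Z => fmap R (t Z)).
Proof.
move=> nR [nt st]; split=> [Z Z' f|Z W] /=; first by rewrite -!fmapM nt.
by rewrite !compA -fmapM st fmapM -!compA nR.
Qed.

Lemma rmtrans_r (R P Q : rmfun) (t : forall Z, hom (P Z) (Q Z)) :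
  rmtrans t ->
  rmtrans (P := rmcomp P R) (Q := rmcomp Q R) (fun Z => t (R Z)).
Proof.
move=> [nt st]; split=> [Z Z' f|Z W] /=; first by rewrite nt.
by rewrite compA nt -compA st compA.
Qed.

Lemma rmtrans_tens X P Q (t : forall Z, hom (P Z) (Q Z)) :
  rmtrans t -> rmtrans (P := rmcomp (rmtens X) P) (Q := rmcomp (rmtens X) Q)
    (fun Z => idm X ⊗m t Z).
Proof. by apply: rmtrans_l => Z Z' W f; apply: assoc_nat. Qed.

(** Both bracketings have the same underlying functor, but their strengths agree only after a use of
    functoriality and associativity; identity transformations therefore have to be inserted between
    them. *)
Lemma rmtrans_assoc (P Q R : rmfun) :
  rmtrans (P := rmcomp P (rmcomp Q R)) (Q := rmcomp (rmcomp P Q) R)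
    (fun Z => idm (P (Q (R Z)))) /\
  rmtrans (P := rmcomp (rmcomp P Q) R) (Q := rmcomp P (rmcomp Q R))
    (fun Z => idm (P (Q (R Z)))).
Proof.
by split; split=> [Z Z' f|Z W] /=; rewrite ?bmap1 comp1m compm1 // fmapM compA.
Qed.

Lemma rmtrans_idr (P : rmfun) :
  rmtrans (P := P) (Q := rmcomp P rmid) (fun Z => idm (P Z)) /\
  rmtrans (P := rmcomp P rmid) (Q := P) (fun Z => idm (P Z)).
Proof.
by split; split=> [Z Z' f|Z W] /=; rewrite ?bmap1 comp1m compm1 ?fmap1 ?comp1m.
Qed.

Lemma rmtrans_idl (P : rmfun) :
  rmtrans (P := P) (Q := rmcomp rmid P) (fun Z => idm (P Z)) /\
  rmtrans (P := rmcomp rmid P) (Q := P) (fun Z => idm (P Z)).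
Proof.
by split; split=> [Z Z' f|Z W] /=; rewrite ?bmap1 comp1m compm1 ?compm1.
Qed.

Lemma rmtrans_lin P Q n (c : 'I_n -> k) (t : 'I_n -> forall Z, hom (P Z) (Q Z)) :
  (forall a, rmtrans (t a)) -> rmtrans (fun Z => \sum_a c a *: t a Z).
Proof.
move=> tt; split=> [Z Z' f|Z W].
  rewrite comp_suml comp_sumr; apply: eq_bigr => a _.
  by rewrite compZl compZr (tt a).1.
rewrite comp_suml bmap_suml comp_sumr; apply: eq_bigr => a _.
by rewrite compZl bmapZl compZr (tt a).2.
Qed.

(* By [Z = 1 ⊗ Z], a transformation of right module functors is determined by
   its component at the unit object. *)
Lemma rmtrans_unit P Q (t u : forall Z, hom (P Z) (Q Z)) :
  (forall W, exists s, rms P munit W ∘ s = idm _) ->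
  rmtrans t -> rmtrans u -> t munit = u munit -> forall W, t W = u W.
Proof.
move=> split_s [nt st] [nu su] e W; have [s es] := split_s W.
apply: (fwd_iso_inj (i := iso_fmap P (lunit W))) => /=; rewrite nt nu.
by rewrite -[t _]compm1 -[u _]compm1 -es !compA -!compA !(compA _ _ s) st su e.
Qed.

Lemma rmtrans_split A B B' (b : hom A (B ⊗ B')) :
  rmtrans (P := rmtens A) (Q := rmcomp (rmtens B) (rmtens B')) (tens_split b).
Proof.
split=> [Z Z' f|Z W]; rewrite tens_split.unlock /=.
  rewrite (post21 _ (bmap_lr _ _ _)) -[b ⊗m f]bmap_rl compA -(bmap1 tens B B').
  by rewrite assoc_nat compA.
rewrite -(bmap1 tens Z W) -compA -assoc_nat compA pentagon.
by rewrite bmapMl !compA.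
Qed.

Lemma rmtrans_merge A B B' (f : hom (B ⊗ B') A) :
  rmtrans (P := rmcomp (rmtens B) (rmtens B')) (Q := rmtens A) (tens_merge f).
Proof.
split=> [Z Z' g|Z W]; rewrite tens_merge.unlock /=.
  rewrite -compA -(iso_conj (assoc_nat _ _ _)) bmap1 compA.
  by rewrite bmap_lr compA bmap_rl.
rewrite bmapMl [RHS]compA assoc_nat bmap1.
apply: (fwd_iso_inj (i := iso_bmap tens (assoc B B' Z) (iso_id W))) => /=.
rewrite -[RHS]compA -bmapMl fwdK bmap1 compm1.
rewrite !compA (post31 _ (esym (pentagon _ _ _ _))) compA.
by rewrite (post21 _ (fwdK _)) compm1.
Qed.

Lemma rms_split1 A W : exists s, rms (rmtens A) munit W ∘ s = idm _.
Proof. by exists (bwd (assoc A munit W)); apply: bwdK. Qed.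

Lemma rms_split2 A B W :
  exists s, rms (rmcomp (rmtens A) (rmtens B)) munit W ∘ s = idm _.
Proof.
exists (bwd (assoc A (B ⊗ munit) W) ∘ (idm A ⊗m bwd (assoc B munit W))) => /=.
by rewrite compA (post21 _ (bwdK _)) compm1 -bmapMr bwdK bmap1.
Qed.

Lemma rmtrans_lev X' X (d : duality X' X) :
  rmtrans (P := rmcomp (rmtens X') (rmtens X)) (Q := rmid) (levC d).
Proof.
split=> [Z Z' f|Z W] /=; first by rewrite levC_nat.
by rewrite comp1m -levC_tens compA.
Qed.

Lemma rmtrans_lcoev X' X (d : duality X' X) :
  rmtrans (P := rmid) (Q := rmcomp (rmtens X) (rmtens X')) (lcoevC d).
Proof.
split=> [Z Z' f|Z W] /=; first by rewrite lcoevC_nat.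
by rewrite compm1 -compA lcoevC_tens compA -bmapMr bwdK bmap1 comp1m.
Qed.

(** Combined with [rmtrans_unit], this shows that every right module transformation from [A ⊗ -] to
    [B ⊗ (B' ⊗ -)] comes from a morphism [A -> B ⊗ B']. *)
Lemma tens_split_unit A B B' (g : hom (A ⊗ munit) (B ⊗ (B' ⊗ munit))) :
  exists b, tens_split b munit = g.
Proof.
exists (fwd (runit (B ⊗ B')) ∘ (bwd (assoc B B' munit) ∘ g) ∘ bwd (runit A)).
rewrite tens_split.unlock; apply: (iso_bwd_inj (i := assoc B B' munit)).
rewrite compA fwdK comp1m; apply: (iso_fwd_inj (i := runit (B ⊗ B'))).
by rewrite runit_nat -compA fwdK compm1.
Qed.

Lemma tens_split_lin A B B' (Z : C) n (c : 'I_n -> k) (b : 'I_n -> hom A (B ⊗ B')) :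
  tens_split (\sum_a c a *: b a) Z = \sum_a c a *: tens_split (b a) Z.
Proof.
rewrite tens_split.unlock bmap_suml comp_sumr; apply: eq_bigr => a _.
by rewrite bmapZl compZr.
Qed.

Lemma tens_split_nat A B B' (b : hom A (B ⊗ B')) Z Z' (f : hom Z Z') :
  tens_split b Z' ∘ (idm A ⊗m f) = (idm B ⊗m (idm B' ⊗m f)) ∘ tens_split b Z.
Proof. exact: (rmtrans_split b).1. Qed.

Lemma tens_merge_nat A B B' (b : hom (B ⊗ B') A) Z Z' (f : hom Z Z') :
  tens_merge b Z' ∘ (idm B ⊗m (idm B' ⊗m f)) = (idm A ⊗m f) ∘ tens_merge b Z.
Proof. exact: (rmtrans_merge b).1. Qed.

Lemma tens_mergeK A A' B B' (f : hom (B ⊗ B') A') (b : hom A (B ⊗ B')) Z :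
  tens_merge f Z ∘ tens_split b Z = (f ∘ b) ⊗m idm Z.
Proof. by rewrite tens_merge.unlock tens_split.unlock compA (post21 _ (fwdK _)) compm1 bmapMl. Qed.

End RightModuleTransformations.

(** * Rotation: bending the legs of a morphism along dualities *)

HB.lock Definition rotate_in (k : fieldType) (C : moncat k) (A A' B B' Y : C)
    (dA : duality A' A) (dB : duality B' B) (b : hom B (A ⊗ Y)) (Z : C) :
    hom (A' ⊗ Z) (Y ⊗ (B' ⊗ Z)) :=
  levC dA (Y ⊗ (B' ⊗ Z)) ∘ (idm A' ⊗m (tens_split b (B' ⊗ Z) ∘ lcoevC dB Z)).
HB.lock Definition rotate_out (k : fieldType) (C : moncat k) (A A' B B' Y : C)
    (dA : duality A A') (dB : duality B B') (f : hom (A ⊗ Y) B) (Z : C) :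
    hom (Y ⊗ (B' ⊗ Z)) (A' ⊗ Z) :=
  (idm A' ⊗m (levC dB Z ∘ tens_merge f (B' ⊗ Z))) ∘ lcoevC dA (Y ⊗ (B' ⊗ Z)).

Section Rotation.
Context (k : fieldType) (C : moncat k) (A A' B B' Y : C).
Context (dA : duality A' A) (dB : duality B' B).
Context (dA' : duality A A') (dB' : duality B B').
Implicit Types (Z : C) (b : hom B (A ⊗ Y)) (f : hom (A ⊗ Y) B).

Lemma rotate_in_lin Z n (c : 'I_n -> k) (b : 'I_n -> hom B (A ⊗ Y)) :
  rotate_in dA dB (\sum_a c a *: b a) Z = \sum_a c a *: rotate_in dA dB (b a) Z.
Proof.
rewrite rotate_in.unlock tens_split_lin comp_suml bmap_sumr comp_sumr.
by apply: eq_bigr => a _; rewrite compZl bmapZr compZr.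
Qed.

Lemma rmtrans_rotate_in b :
  rmtrans (P := rmtens A') (Q := rmcomp (rmtens Y) (rmtens B')) (rotate_in dA dB b).
Proof.
rewrite rotate_in.unlock.
have tb := rmtrans_r (rmtens B') (rmtrans_split b).
have tb2 := rmtrans_comp tb (rmtrans_assoc (rmtens A) (rmtens Y) (rmtens B')).2.
have tb3 := rmtrans_tens A' (rmtrans_comp (rmtrans_lcoev dB) tb2).
have tb4 := rmtrans_comp tb3 (rmtrans_assoc (rmtens A') (rmtens A) (rmcomp (rmtens Y) (rmtens B'))).1.
have te := rmtrans_comp (rmtrans_r (rmcomp (rmtens Y) (rmtens B')) (rmtrans_lev dA))
  (rmtrans_idl (rmcomp (rmtens Y) (rmtens B'))).2.
apply: rmtrans_ext (rmtrans_comp (rmtrans_idr (rmtens A')).1 (rmtrans_comp tb4 te)) _.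
by move=> Z /=; rewrite compm1 !comp1m.
Qed.

Lemma rmtrans_rotate_out f :
  rmtrans (P := rmcomp (rmtens Y) (rmtens B')) (Q := rmtens A') (rotate_out dA' dB' f).
Proof.
rewrite rotate_out.unlock.
have tf := rmtrans_r (rmtens B') (rmtrans_merge f).
have tf2 := rmtrans_comp (rmtrans_assoc (rmtens A) (rmtens Y) (rmtens B')).1 tf.
have tf3 := rmtrans_tens A' (rmtrans_comp tf2 (rmtrans_lev dB')).
have tf4 := rmtrans_comp (rmtrans_assoc (rmtens A') (rmtens A) (rmcomp (rmtens Y) (rmtens B'))).2 tf3.
have te := rmtrans_comp (rmtrans_idl (rmcomp (rmtens Y) (rmtens B'))).1
  (rmtrans_r (rmcomp (rmtens Y) (rmtens B')) (rmtrans_lcoev dA')).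
apply: rmtrans_ext (rmtrans_comp te (rmtrans_comp tf4 (rmtrans_idr (rmtens A')).2)) _.
by move=> Z /=; rewrite comp1m !compm1.
Qed.

Lemma rotate_in_nat b Z Z' (g : hom Z Z') :
  rotate_in dA dB b Z' ∘ (idm A' ⊗m g) =
  (idm Y ⊗m (idm B' ⊗m g)) ∘ rotate_in dA dB b Z.
Proof. exact: (rmtrans_rotate_in b).1. Qed.

(** Slides [b] past the cap of a loop: the loop arrives coloured by [B] and is capped off in colour
    [B] instead of [A], while [b] is left behind in rotated form. [merge_coev] does the same at the
    cup. *)
Lemma ev_split b Z : levC dA (Y ⊗ Z) ∘ (idm A' ⊗m tens_split b Z) =
  (idm Y ⊗m levC dB Z) ∘ rotate_in dA dB b (B ⊗ Z).
Proof.
rewrite rotate_in.unlock compA -levC_nat -!compA -!bmapMr; congr (_ ∘ bmap _ _ _).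
by rewrite compA -tens_split_nat -compA zigLC compm1.
Qed.

Lemma merge_coev f Z : (idm A' ⊗m tens_merge f Z) ∘ lcoevC dA' (Y ⊗ Z) =
  rotate_out dA' dB' f (B ⊗ Z) ∘ (idm Y ⊗m lcoevC dB' Z).
Proof.
rewrite rotate_out.unlock -compA lcoevC_nat compA -bmapMr; congr (bmap _ _ _ ∘ _).
by rewrite -compA tens_merge_nat compA zagLC comp1m.
Qed.

Lemma rotate_coev b Z : (idm A ⊗m rotate_in dA dB b Z) ∘ lcoevC dA Z =
  tens_split b (B' ⊗ Z) ∘ lcoevC dB Z.
Proof.
by rewrite rotate_in.unlock bmapMr -compA -lcoevC_nat compA zigLC comp1m.
Qed.

Lemma ev_rotate f Z : levC dA' Z ∘ (idm A ⊗m rotate_out dA' dB' f Z) =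
  levC dB' Z ∘ tens_merge f (B' ⊗ Z).
Proof.
by rewrite rotate_out.unlock bmapMr compA levC_nat -compA zagLC compm1.
Qed.

(** Rotation has an inverse, so rotated bases still span. *)
Lemma rotate_in_surj (g : hom (A' ⊗ munit) (Y ⊗ (B' ⊗ munit))) :
  exists b, rotate_in dA dB b munit = g.
Proof.
have [g0 <-] := tens_split_unit g.
(* The inverse rotation of [g0]. Being a right module transformation, it is determined by its
   component at the unit and hence equals some [tens_split b]. *)
pose t Z := (idm A ⊗m ((idm Y ⊗m levC dB Z) ∘ tens_split g0 (B ⊗ Z)))
  ∘ lcoevC dA (B ⊗ Z).
have [b bt] := tens_split_unit (t munit).
have rt : rmtrans (P := rmtens B) (Q := rmcomp (rmtens A) (rmtens Y)) t.
  have tg := rmtrans_r (rmtens B) (rmtrans_split g0).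
  have tg2 := rmtrans_comp tg (rmtrans_assoc (rmtens Y) (rmtens B') (rmtens B)).2.
  have te := rmtrans_comp (rmtrans_tens Y (rmtrans_lev dB)) (rmtrans_idr (rmtens Y)).2.
  have tge := rmtrans_tens A (rmtrans_comp tg2 te).
  have tc := rmtrans_comp (rmtrans_idl (rmtens B)).1
    (rmtrans_r (rmtens B) (rmtrans_lcoev dA)).
  have tc2 := rmtrans_comp tc (rmtrans_assoc (rmtens A) (rmtens A') (rmtens B)).2.
  apply: rmtrans_ext (rmtrans_comp tc2 tge) _.
  by move=> Z /=; rewrite compm1 !comp1m.
have bE := rmtrans_unit (@rms_split1 _ _ B) (rmtrans_split b) rt bt.
exists b; rewrite rotate_in.unlock bE /t.
rewrite -(compA (idm A ⊗m _)) lcoevC_nat compA -bmapMr [X in _ ∘ X]bmapMr.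
rewrite compA levC_nat -compA zagLC compm1.
by rewrite -compA tens_split_nat compA -bmapMr zagLC bmap1 comp1m.
Qed.

Lemma lev_lcoev (s : k) Z : ev dA' ∘ coev dA = s *: idm munit ->
  levC dA' Z ∘ lcoevC dA Z = s *: idm Z.
Proof.
move=> e; rewrite levCE lcoevCE !compA (post21 _ (fwdK _)) compm1.
rewrite (post21 _ (esym (bmapMl _ _ _ _))) e bmapZl bmap1 compZr compm1 compZl.
by rewrite bwdK.
Qed.

End Rotation.

(** * Rotated dual bases *)

Section Averaging.
Context (k : closedFieldType) (C : moncat k).
Hypothesis kerC : has_kernels C.
Hypothesis ssC : semisimple C.
Hypothesis rigC : rigid C.
Hypothesis brick1 : brick (munit : C).
Context (n : nat) (S S' : 'I_n -> C) (r : 'I_n -> k).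
Hypothesis genS : generating S.
Hypothesis brickS : forall i, brick (S i).
Hypothesis orthS : forall i j (f : hom (S i) (S j)), i != j -> f = 0.
Context (d : forall i, duality (S' i) (S i)) (d' : forall i, duality (S i) (S' i)).
Hypothesis rE : forall i, ev (d' i) ∘ coev (d i) = r i *: idm munit.

(** The coevaluation is nonzero, so it has a retraction [q]; transposing [q] gives an endomorphism
    of a brick, so [q] is a multiple of [ev (d' i)]. A vanishing circle would make the identity of
    the unit vanish. *)
Lemma circle_neq0 i : r i != 0.
Proof.
have nz : coev (d i) != 0.
  case: (brickS i) => nzS _; apply: contra_neq nzS => e.
  by rewrite -(duality_zig (d i)) e bmap0l compm0 comp0m.
have [q qE] := brick_retraction kerC ssC brick1 nz.
have [_ /(_ (lmate (d' i) q))[c ec]] := brickS i.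
case: (brick1) => nz1 _; apply: contra_neq nz1 => r0.
rewrite -qE -(ev_lmate (d' i) q) ec bmapZl bmap1 compZr compm1 compZl rE r0.
by rewrite scale0r scaler0.
Qed.

Lemma dual_orth i l (f : hom (S' i) (S' l)) : i != l -> f = 0.
Proof.
move=> il; apply: (ev_injl (d := d l)).
rewrite bmap0l compm0 -[LHS](ev_rmate (d i)) [rmate _ _]orthS ?bmap0r ?compm0 //.
by rewrite eq_sym.
Qed.

Lemma dual_scalar i (f : hom (S' i) (S' i)) : exists c, f = c *: idm (S' i).
Proof.
have [_ /(_ (rmate (d i) (ev (d i) ∘ (f ⊗m idm (S i)))))[c ec]] := brickS i.
exists c; apply: (ev_injl (d := d i)).
by rewrite -[LHS](ev_rmate (d i)) ec bmapZl bmapZr.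
Qed.

Lemma dual_unit_orth i l (f : hom (S' i ⊗ munit) (S' l ⊗ munit)) : i != l -> f = 0.
Proof.
move=> il; apply: (iso_fwd_inj (i := runit (S' l))).
apply: (bwd_iso_inj (i := runit (S' i))).
by rewrite compm0 comp0m; apply: dual_orth.
Qed.

Lemma dual_unit_scalar i (f : hom (S' i ⊗ munit) (S' i ⊗ munit)) :
  exists c, f = c *: idm (S' i ⊗ munit).
Proof.
have [c ec] := dual_scalar (fwd (runit (S' i)) ∘ f ∘ bwd (runit (S' i))).
exists c; apply: (iso_fwd_inj (i := runit (S' i))).
apply: (bwd_iso_inj (i := runit (S' i))).
by rewrite ec compZr compZl compm1 bwdK.
Qed.

(** Obtained by transposing a decomposition of the identity of a dual of [W]. The factor [munit]
    matches the components at the unit, to which module transformations are reduced. *)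
Lemma dual_unit_generating : generating (fun i => S' i ⊗ munit).
Proof.
move=> W; have dW := rdualP rigC W; set V := rdual rigC W in dW.
have [m [j [i [p ip]]]] := genS V.
pose l a := lmate (d (j a)) (ev dW ∘ (idm W ⊗m i a)).
pose q a := lmate dW (ev (d (j a)) ∘ (idm (S' (j a)) ⊗m p a)).
exists m, j, (fun a => q a ∘ fwd (runit (S' (j a)))),
  (fun a => bwd (runit (S' (j a))) ∘ l a).
under eq_bigr do rewrite compA (post21 _ (bwdK _)) compm1.
apply: (ev_injl (d := dW)); rewrite bmap_suml comp_sumr bmap1 compm1.
rewrite -[RHS]compm1 -[in RHS](bmap1 tens) -[in RHS]ip bmap_sumr comp_sumr.
apply: eq_bigr => a _; rewrite bmapMl compA ev_lmate -compA bmap_rl -bmap_lr compA.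
by rewrite ev_lmate bmapMr compA.
Qed.

(* The bases [b], [f] of [Hom(S j, S i ⊗ Y)] rotate to bases of
   [Hom(S' i, Y ⊗ S' j)]; closing up with the evaluations [d'] shows that the
   duality pairings differ by the factor [r j / r i]. *)
Lemma rotated_casimir Y j (m : 'I_n -> nat)
    (b : forall i, 'I_(m i) -> hom (S j) (S i ⊗ Y))
    (f : forall i, 'I_(m i) -> hom (S i ⊗ Y) (S j)) :
  (forall i g, exists c : 'I_(m i) -> k, g = \sum_a c a *: b i a) ->
  (forall i a a', f i a ∘ b i a' = (a == a')%:R *: idm (S j)) ->
  forall Z, \sum_i \sum_a r i *: (rotate_in (d i) (d j) (b i a) Z ∘
    rotate_out (d' i) (d' j) (f i a) Z) = r j *: idm (Y ⊗ (S' j ⊗ Z)).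
Proof.
move=> spanb dualb.
pose u i a := rotate_in (d i) (d j) (b i a).
pose v i a := rotate_out (d' i) (d' j) (f i a).
(* Both sides of the goal are right module transformations, so the component at the unit is enough;
   there [casimir] applies with the rescaled duals [(r i / r j) *: v i a]. *)
have at1 : \sum_i \sum_a u i a munit ∘ ((r i / r j) *: v i a munit) =
    idm (Y ⊗ (S' j ⊗ munit)).
  apply: (casimir (S := fun i => S' i ⊗ munit)).
  - exact: dual_unit_generating.
  - exact: dual_unit_orth.
  - move=> i g; have [b0 <-] := rotate_in_surj (d i) (d j) g.
    by have [c ->] := spanb i b0; exists c; rewrite rotate_in_lin.
  move=> i a a'; have [c ec] := dual_unit_scalar (v i a munit ∘ u i a' munit).
  rewrite compZl ec scalerA; congr (_ *: _).
  (* The scalar [c] is read off by closing the loop, which multiplies it by [r i]. Sliding the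
     rotated maps off the loop instead leaves the original pairing times the circle [r j]. *)
  have : levC (d' i) munit ∘ (idm (S i) ⊗m (v i a munit ∘ u i a' munit))
      ∘ lcoevC (d i) munit = ((a == a')%:R * r j) *: idm munit.
    rewrite bmapMr compA ev_rotate -[LHS]compA rotate_coev compA.
    rewrite (post21 _ (tens_mergeK _ _ _)) dualb bmapZl bmap1 compZr compm1 compZl.
    by rewrite (lev_lcoev _ (rE j)) scalerA.
  rewrite ec bmapZr bmap1 compZr compm1 compZl (lev_lcoev _ (rE i)) scalerA.
  move/eqP; rewrite -subr_eq0 -scalerBl scaler_eq0; case: brick1 => /negPf-> _.
  rewrite orbF subr_eq0 => /eqP e.
  rewrite mulrAC [r i * c]mulrC e -mulrA divff ?mulr1 //; exact: circle_neq0.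
have tu i a := rmtrans_rotate_in (d i) (d j) (b i a).
have tv i a := rmtrans_rotate_out (d' i) (d' j) (f i a).
have tuv i a := rmtrans_comp (tv i a) (tu i a).
pose W := rmcomp (rmtens Y) (rmtens (S' j)).
have tall : rmtrans (P := W) (Q := W)
    (fun Z => \sum_i \sum_a r i *: (u i a Z ∘ v i a Z)).
  apply: rmtrans_ext (rmtrans_lin (fun=> 1) (fun i => rmtrans_lin (fun=> r i) (tuv i))) _.
  by move=> Z; apply: eq_bigr => i _; rewrite scale1r.
have tid : rmtrans (P := W) (Q := W) (fun Z => r j *: idm _).
  apply: rmtrans_ext (rmtrans_lin (fun _ : 'I_1 => r j) (fun=> rmtrans_id _)) _.
  by move=> Z; rewrite big_ord1.
apply: (rmtrans_unit (@rms_split2 _ _ Y (S' j)) tall tid).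
rewrite /= -at1 scaler_sumr; apply: eq_bigr => i _.
rewrite scaler_sumr; apply: eq_bigr => a _.
by rewrite compZr scalerA mulrCA mulfV ?mulr1 // circle_neq0.
Qed.

End Averaging.

(** The analogue for [F] of a Frobenius homomorphism of a ring extension, that is, of a bimodule map
    back to the smaller ring; [cexp_fmap] is the normalization. *)
Record expectation (k : fieldType) (C : moncat k) (M : bimodcat C)
    (F : bimodfunctor (regular_bimod C) M) := Expectation {
  cexp :> forall T X : C, hom (F T) (F X) -> hom T X;
  cexp_lin : forall T X, linear (@cexp T X);
  cexp_nat : forall T T' X X' (b : hom X X') (h : hom (F T) (F X)) (a : hom T' T),
    cexp (fmap F b ∘ h ∘ fmap F a) = b ∘ cexp h ∘ a;
  cexp_fmap : forall T X (f : hom T X), cexp (fmap F f) = f;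
  cexp_hL : forall Y T X (h : hom (F T) (F X)), cexp (hL Y h) = idm Y ⊗m cexp h;
  cexp_hR : forall T X (h : hom (F T) (F X)) Y, cexp (hR h Y) = cexp h ⊗m idm Y
}.

(** * The two-sided expectation *)

Section Average.
Context (k : closedFieldType) (C : moncat k) (M : bimodcat C).
Context (F : bimodfunctor (regular_bimod C) M).
Hypothesis kerC : has_kernels C.
Hypothesis ssC : semisimple C.
Hypothesis rigC : rigid C.
Hypothesis brick1 : brick (munit : C).
Hypothesis brickF1 : brick (F munit).
Context (n : nat) (S S' : 'I_n -> C) (r w : 'I_n -> k).
Hypothesis genS : generating S.
Hypothesis brickS : forall i, brick (S i).
Hypothesis orthS : forall i j (f : hom (S i) (S j)), i != j -> f = 0.
Context (d : forall i, duality (S' i) (S i)) (d' : forall i, duality (S i) (S' i)).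
Hypothesis rE : forall i, ev (d' i) ∘ coev (d i) = r i *: idm munit.
Hypothesis wE : forall i, ev (d i) ∘ coev (d' i) = w i *: idm munit.
Hypothesis dim_neq0 : \sum_i r i * w i != 0.
Implicit Types (T X Y : C).

Local Notation E0 := (expect kerC ssC rigC brick1 brickF1).

Definition average T X (h : hom (F T) (F X)) : hom T X :=
  \sum_i r i *: (levC (d i) X ∘ (idm (S' i) ⊗m E0 (hL (S i) h)) ∘ lcoevC (d' i) T).

Lemma average_lin T X : linear (@average T X).
Proof.
move=> c f g; rewrite /average scaler_sumr -big_split; apply: eq_bigr => i _ /=.
rewrite hL_lin expect_lin bmap_linr comp_linr comp_linl scalerDr !scalerA.
by rewrite mulrC.
Qed.

Lemma average_nat T T' X X' (b : hom X X') (h : hom (F T) (F X)) (a : hom T' T) :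
  average (fmap F b ∘ h ∘ fmap F a) = b ∘ average h ∘ a.
Proof.
rewrite /average comp_sumr comp_suml; apply: eq_bigr => i _.
rewrite compZr compZl !hLM !hL_fmap expect_nat !bmapMr !compA levC_nat.
by rewrite -(compA _ (lcoevC _ _) a) lcoevC_nat !compA.
Qed.

Lemma average_fmap T X (f : hom T X) :
  average (fmap F f) = (\sum_i r i * w i) *: f.
Proof.
rewrite /average scaler_suml; apply: eq_bigr => i _.
rewrite hL_fmap expect_fmap levC_nat -compA (lev_lcoev _ (wE i)).
by rewrite compZr compm1 scalerA.
Qed.

Lemma average_hR T X (h : hom (F T) (F X)) Y : average (hR h Y) = average h ⊗m idm Y.
Proof.
rewrite /average bmap_suml; apply: eq_bigr => i _; rewrite bmapZl; congr (_ *: _).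
have -> : hL (S i) (hR h Y) = fmap F (fwd (assoc (S i) X Y)) ∘ hR (hL (S i) h) Y
    ∘ fmap F (bwd (assoc (S i) T Y)).
  by rewrite hLR -compA -fmapM bwdK fmap1 compm1.
rewrite expect_nat expect_hR !bmapMr !compA -(compA _ (_ ⊗m bwd _)).
rewrite -lcoevC_tens !bmapMl -levC_tens !compA.
by rewrite (post22 _ (assoc_nat _ _ _)).
Qed.

(** The identity of [S i ⊗ Y] is inserted as a sum over simple objects, and naturality pulls both
    factors of each term out of [E0]; the strand [Y] survives only in the bases. *)
Lemma expect_split Y i (m : 'I_n -> nat)
    (b : forall j, 'I_(m j) -> hom (S j) (S i ⊗ Y))
    (f : forall j, 'I_(m j) -> hom (S i ⊗ Y) (S j)) T X (h : hom (F T) (F X)) :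
  \sum_j \sum_a b j a ∘ f j a = idm (S i ⊗ Y) ->
  E0 (hL (S i) (hL Y h)) = \sum_j \sum_a
    tens_split (b j a) X ∘ E0 (hL (S j) h) ∘ tens_merge (f j a) T.
Proof.
move=> bf; have -> : hL (S i) (hL Y h) = \sum_j \sum_a
    fmap F (tens_split (b j a) X) ∘ hL (S j) h ∘ fmap F (tens_merge (f j a) T).
  apply: (fwd_iso_inj (i := iso_fmap F (assoc (S i) Y T))) => /=.
  rewrite -hL_assoc -[hL (S i ⊗ Y) h]compm1 -fmap1 -(bmap1 tens) -bf.
  rewrite bmap_suml fmap_sum !comp_sumr comp_suml; apply: eq_bigr => j _.
  rewrite bmap_suml fmap_sum !comp_sumr comp_suml; apply: eq_bigr => a _.
  rewrite bmapMl fmapM [X in _ ∘ X = _]compA -hL_nat tens_split.unlock.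
  rewrite tens_merge.unlock -[RHS]compA -[X in _ = _ ∘ X]fmapM.
  by rewrite -[X in _ = _ ∘ fmap F X]compA fwdK compm1 fmapM !compA.
pose l (g : hom (F (S i ⊗ (Y ⊗ T))) (F (S i ⊗ (Y ⊗ X)))) := E0 g.
have lD : {morph l : x y / x + y}.
  by move=> x y; have := expect_lin kerC ssC rigC brick1 brickF1 1 x y; rewrite !scale1r.
have l0 : l 0 = 0 by apply: (addrI (l 0)); rewrite -lD !addr0.
rewrite -/(l _) (big_morph l lD l0); apply: eq_bigr => j _.
by rewrite (big_morph l lD l0); apply: eq_bigr => a _; rewrite /l expect_nat.
Qed.

(** A loop around [S i] enclosing a strand [Y] is rewritten as loops around the simple objects [S j]
    with rotated bases outside. Summing over [i] with weights [r i], these bases collapse by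
    [rotated_casimir] to the weight [r j]. *)
Lemma average_hL Y T X (h : hom (F T) (F X)) : average (hL Y h) = idm Y ⊗m average h.
Proof.
have basis i j : {x : {m : nat &
      ('I_m -> hom (S j) (S i ⊗ Y)) * ('I_m -> hom (S i ⊗ Y) (S j))}%type |
    (forall g, exists c : 'I_(tag x) -> k, g = \sum_a c a *: (tagged x).1 a) /\
    forall a a', (tagged x).2 a ∘ (tagged x).1 a' = (a == a')%:R *: idm (S j)}.
  apply: constructive_indefinite_description.
  have [m [b [f [sp du]]]] := dual_bases kerC ssC (S i ⊗ Y) (brickS j).
  by exists (existT _ m (b, f)).
pose m i j := tag (sval (basis i j)).
pose b i j : 'I_(m i j) -> hom (S j) (S i ⊗ Y) := (tagged (sval (basis i j))).1.
pose f i j : 'I_(m i j) -> hom (S i ⊗ Y) (S j) := (tagged (sval (basis i j))).2.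
have spanb i j : forall g, exists c : 'I_(m i j) -> k, g = \sum_a c a *: b i j a.
  exact: (proj2_sig (basis i j)).1.
have dualb i j : forall a a', f i j a ∘ b i j a' = (a == a')%:R *: idm (S j).
  exact: (proj2_sig (basis i j)).2.
have bf i : \sum_j \sum_a b i j a ∘ f i j a = idm (S i ⊗ Y).
  exact: (casimir genS orthS (spanb i) (dualb i)).
rewrite /average bmap_sumr.
under eq_bigr => i _.
  rewrite (expect_split _ (bf i)) bmap_sumr comp_sumr comp_suml scaler_sumr.
  under eq_bigr => j _.
    rewrite bmap_sumr comp_sumr comp_suml scaler_sumr.
    under eq_bigr => a _.
      rewrite !bmapMr !compA (ev_split _ (d j)) -(compA _ (_ ⊗m tens_merge _ _)).
      rewrite (merge_coev _ (d' j)).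
      over.
    over.
  over.
(* For fixed [j] the sum over [i] is now the one evaluated by [rotated_casimir], once [A] is moved
   past the rotated bases. *)
rewrite exchange_big; apply: eq_bigr => j _ /=; rewrite bmapZr !bmapMr.
set A := E0 (hL (S j) h).
have cas := rotated_casimir kerC ssC rigC brick1 genS brickS orthS rE
  (fun i => spanb i j) (fun i => dualb i j) (S j ⊗ T).
transitivity ((idm Y ⊗m levC (d j) X) ∘ (idm Y ⊗m (idm (S' j) ⊗m A))
    ∘ (r j *: idm (Y ⊗ (S' j ⊗ (S j ⊗ T)))) ∘ (idm Y ⊗m lcoevC (d' j) T)); last first.
  by rewrite compZr compm1 compZl.
rewrite -cas comp_sumr comp_suml; apply: eq_bigr => i _.
rewrite comp_sumr comp_suml; apply: eq_bigr => a _.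
rewrite compZr compZl; congr (_ *: _); rewrite !compA.
by rewrite (post22 _ (rotate_in_nat _ _ _ _)).
Qed.

Lemma expectation_exists : inhabited (expectation F).
Proof.
constructor; pose D := \sum_i r i * w i.
exists (fun T X h => D^-1 *: average h).
- move=> T X c f g; rewrite average_lin scalerDr !scalerA; congr (_ + _).
  by rewrite mulrC.
- by move=> T T' X X' b h a; rewrite average_nat compZr compZl.
- by move=> T X f; rewrite average_fmap scalerA mulVf // scale1r.
- by move=> Y T X h; rewrite average_hL bmapZr.
- by move=> T X h Y; rewrite average_hR bmapZl.
Qed.

End Average.

(** * The left adjoint and the theorem *)

Section LeftAdjoint.
Context (k : closedFieldType) (C : moncat k) (M : bimodcat C).
Hypothesis kerC : has_kernels C.
Hypothesis ssC : semisimple C.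
Hypothesis kerM : has_kernels M.
Hypothesis ssM : semisimple M.
Context (rigC : rigid C) (F : bimodfunctor (regular_bimod C) M).
Hypothesis brick1 : brick (munit : C).
Hypothesis brickF1 : brick (F munit).
Context (E : expectation F).
Context (R0 : M -> C) (e : forall d, hom (F (R0 d)) d).
Hypothesis univ : forall d, universal_arrow (F := F) (e d).
Implicit Types (X Y T : C) (c d m : M).

(** Bending the added leg back with [coevR] recovers [v] from its pairing with the dual of [X]. *)
Lemma pair_nondeg d X (v : hom d (F X)) (dX : duality X (rdual rigC X)) :
  fmap F (ev dX) ∘ fwd (rF F X _) ∘ (v ◁m idm _) = 0 -> v = 0.
Proof.
move=> q0.
have <- : fmap F (fwd (lunit X)) ∘ fwd (rF F munit X) ∘ ((fmap F (ev dX)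
    ∘ fwd (rF F X _) ∘ (v ◁m idm _)) ◁m idm X) ∘ coevR dX d = v.
  rewrite !bmapMl !compA -(compA _ (_ ◁m _) (coevR _ _)) -coevR_nat compA.
  rewrite (post22 _ (rF_nat F _ _)) !(post31 _ (esym (F_rcoevC F dX X))).
  have := lmate_ev dX (idm X); rewrite /lmate bmap1 compm1 => lm.
  by rewrite -!fmapM lm fmap1 comp1m.
by rewrite q0 bmap0l compm0 comp0m.
Qed.

(* A nonzero [v] pairs with [X] to a nonzero, hence split, map [d ◁ Z -> F 1].  Its
   section is [(u ◁ Z) F(c)] for some [u : F (1 ⊗ V) -> d], so [E (v u)] is nonzero,
   and [u] factors through [e d]. *)
Lemma cexp_nondeg d X (v : hom d (F X)) : E _ _ (v ∘ e d) = 0 -> v = 0.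
Proof.
move=> Ev0; apply/eqP/negP => /negP nzv.
have dX := rdualP rigC X; set Z := rdual rigC X in dX.
have dZ := rdualP rigC Z; set V := rdual rigC Z in dZ.
pose q := fmap F (ev dX) ∘ fwd (rF F X Z) ∘ (v ◁m idm Z).
have nzq : q != 0 by apply: contra_neq nzv => /pair_nondeg.
have [s qs] := brick_section kerM ssM brickF1 nzq.
pose u : hom (F (munit ⊗ V)) d := evR dZ d ∘ (s ◁m idm V) ∘ bwd (rF F munit V).
have us : (u ◁m idm Z) ∘ bwd (rF F (munit ⊗ V) Z) ∘ fmap F (rcoevC dZ munit) = s.
  rewrite F_rcoevC !compA (post21 _ (fwdK _)) compm1 -bmapMl.
  rewrite -(compA _ (bwd _)) fwdK compm1 bmapMl.
  by rewrite -(post22 _ (coevR_nat _ _)) zagR comp1m.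
have qE : fmap F (ev dX) ∘ hR (v ∘ u) Z ∘ fmap F (rcoevC dZ munit) = fmap F (idm munit).
  by rewrite fmap1 -qs -us /q hR.unlock bmapMl !compA.
have := congr1 (@cexp _ _ _ _ E _ _) qE; rewrite cexp_nat cexp_hR cexp_fmap.
have -> : E _ _ (v ∘ u) = 0.
  rewrite -(facE univ u) compA -[X in X ∘ _]comp1m -fmap1 cexp_nat Ev0.
  by rewrite compm0 comp0m.
rewrite bmap0l compm0 comp0m; case: brick1 => nz1 _ e0.
by case/eqP: nz1; rewrite -e0.
Qed.

(* Both sides have the same dimension: [Hom(R0 d, X)] and [Hom(X, R0 d)] do by
   semisimplicity, as do [Hom(F X, d)] and [Hom(d, F X)]. *)
Lemma cexp_surj d X (w : hom (R0 d) X) : exists v : hom d (F X), E _ _ (v ∘ e d) = w.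
Proof.
have [t lt t0] := semisimple_transpose kerC ssC (R0 d) X.
have [t' lt' t'0] := semisimple_transpose kerM ssM (F X) d.
apply: (linear_inj_surj (f := fun v : hom d (F X) => E _ _ (v ∘ e d))
  (g := fun x => t' (e d ∘ fmap F (t x)))).
- by move=> a f g; rewrite comp_linl cexp_lin.
- by move=> a f g; rewrite lt fmap_lin comp_linr lt'.
- exact: cexp_nondeg.
- move=> x /t'0 ex; apply: t0; apply: (fac_inj univ).
  by rewrite ex fmap0 compm0.
Qed.

Lemma cexp_inj d X (v w : hom d (F X)) : E _ _ (v ∘ e d) = E _ _ (w ∘ e d) -> v = w.
Proof.
move=> vw; apply/eqP; rewrite -subr_eq0; apply/eqP/cexp_nondeg.
rewrite -[v - w]addrC -scaleN1r comp_linl cexp_lin vw scaleN1r.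
by rewrite addNr.
Qed.

Lemma lunit_sig d : {v : hom d (F (R0 d)) | E _ _ (v ∘ e d) = idm (R0 d)}.
Proof. exact/constructive_indefinite_description/cexp_surj. Qed.

Definition Lunit_fun d : hom d (F (R0 d)) := proj1_sig (lunit_sig d).

Lemma LunitE d : E _ _ (Lunit_fun d ∘ e d) = idm (R0 d).
Proof. exact: (proj2_sig (lunit_sig d)). Qed.

Lemma cexp_postl T X X' (b : hom X X') (h : hom (F T) (F X)) :
  E _ _ (fmap F b ∘ h) = b ∘ E _ _ h.
Proof. by rewrite -[_ ∘ h]compm1 -fmap1 cexp_nat compm1. Qed.

Lemma cexp_prer T T' X (h : hom (F T) (F X)) (a : hom T' T) :
  E _ _ (h ∘ fmap F a) = E _ _ h ∘ a.
Proof. by rewrite -[h ∘ _]comp1m compA -fmap1 cexp_nat comp1m. Qed.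

Local Notation R := (Rbimod rigC univ).

(** By [cexp_inj], maps [d -> F X] may be compared after composing with [e d] and applying [E],
    which turns [Lunit_fun] into the identity; compatibility with the two actions then reduces to
    [cexp_hL] and [cexp_hR]. *)
Definition Lunit : bimodtrans (idbimod M) (compbimod F R).
Proof.
refine (@BimodTrans k C M M (idbimod M) (compbimod F R) Lunit_fun _ _ _) => /=.
- move=> d d' h; apply: cexp_inj; rewrite -compA -(RmapE univ h) compA.
  by rewrite cexp_prer LunitE comp1m -compA cexp_postl LunitE compm1.
- move=> X d; rewrite compm1 fwd_lRiso; apply: cexp_inj; rewrite LunitE.
  apply: (fwd_iso_inj (i := lRiso rigC univ X d)); rewrite fwd_lRiso comp1m.
  rewrite -cexp_prer -(compA _ (e _)) lRE -!compA cexp_postl.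
  rewrite (compA (idm X ▷m Lunit_fun d)) -bmapMr.
  have -> : fwd (lstr F X (R0 d)) ∘ ((idm X ▷m (Lunit_fun d ∘ e d))
      ∘ bwd (lF F X (R0 d))) = hL X (Lunit_fun d ∘ e d) by rewrite hL.unlock compA.
  by rewrite cexp_hL LunitE bmap1 compm1.
- move=> d X; rewrite compm1 fwd_rRiso; apply: cexp_inj; rewrite LunitE.
  apply: (fwd_iso_inj (i := rRiso rigC univ d X)); rewrite fwd_rRiso comp1m.
  rewrite -cexp_prer -(compA _ (e _)) rRE -!compA cexp_postl.
  rewrite (compA (Lunit_fun d ◁m idm X)) -bmapMl.
  have -> : fwd (rstr F (R0 d) X) ∘ (((Lunit_fun d ∘ e d) ◁m idm X)
      ∘ bwd (rF F (R0 d) X)) = hR (Lunit_fun d ∘ e d) X by rewrite hR.unlock compA.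
  by rewrite cexp_hR LunitE bmap1 compm1.
Defined.

Definition Lcounit : bimodtrans (compbimod R F) (idbimod (regular_bimod C)).
Proof.
refine (@BimodTrans k C (regular_bimod C) (regular_bimod C) (compbimod R F)
  (idbimod (regular_bimod C)) (fun T => E _ _ (e (F T))) _ _ _) => /=.
- by move=> T T' h; rewrite -cexp_prer (RmapE univ) cexp_postl.
- move=> X T; rewrite comp1m fwd_lRiso -cexp_prer fmapM compA (RmapE univ).
  by rewrite -compA lRE -cexp_hL hL.unlock compA.
- move=> T X; rewrite comp1m fwd_rRiso -cexp_prer fmapM compA (RmapE univ).
  by rewrite -compA rRE -cexp_hR hR.unlock compA.
Defined.

Lemma left_adjunction : bimod_adjunction R F.
Proof.
exists Lunit Lcounit => [d|T] /=; first by rewrite -cexp_prer (RmapE univ) LunitE.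
by apply: cexp_inj; rewrite -compA cexp_postl LunitE compm1 comp1m.
Qed.

End LeftAdjoint.

(** * Double duals, traces and the case of fusion categories *)

Section DoubleDual.
Context (k : fieldType) (C : moncat k) (X X' X'' : C).
Context (d : duality X'' X') (a : iso X X'').

(** Provides the opposite duality [d'] for a simple object, which is needed to close loops on both
    sides. *)
Definition double_dual : duality X X'.
Proof.
exists (ev d ∘ (fwd a ⊗m idm X')) ((idm X' ⊗m bwd a) ∘ coev d).
- rewrite bmapMr bmapMl !compA (post22 _ (assoc_nat _ _ _)).
  rewrite (post21 _ (esym (bmapMr _ _ _ _))) -bmapMl bwdK !bmap1 compm1.
  exact: duality_zig.
- apply: (iso_fwd_inj (i := a)).
  rewrite bmapMl bmapMr !compA -lunit_nat (post21 _ (bmap_rl _ _ _)).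
  rewrite -(bmap_lr _ (ev d)) compA (post21 _ (bmap_rl _ _ _)).
  rewrite (post22 _ (iso_conj (assoc_nat _ _ _))).
  have e : (fwd a ⊗m (idm X' ⊗m fwd a)) ∘ (idm X ⊗m (idm X' ⊗m bwd a)) =
      fwd a ⊗m idm (X' ⊗ X'') by rewrite -bmapM compm1 -bmapMr bwdK bmap1.
  rewrite (post21 _ e) (post21 _ (bmap_lr _ _ _)) -(bmap_rl _ _ (coev d)) compA.
  by rewrite (post22 _ (iso_conj (runit_nat _))) duality_zag comp1m compm1.
Defined.

End DoubleDual.

(** Recognizes the explicit formula for [dualm] as a transpose; this turns the trace of
    [dualm (bwd a)] into the left circle. *)
Lemma ev_dualm (k : fieldType) (C : tensor_cat k) (X Y : C) (f : hom X Y) :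
  evd X ∘ (dualm f ⊗m idm X) = evd Y ∘ (idm (dualobj Y) ⊗m f).
Proof.
rewrite -[RHS](ev_lmate (ldualP (tcat_rigid C) X)); congr (_ ∘ (_ ⊗m _)).
rewrite /lmate rcoevCE bmapMl !compA /dualm.
congr (_ ∘ _ ∘ _); rewrite -!compA; congr (_ ∘ (_ ∘ _)).
by rewrite -(iso_conj (assoc_nat _ _ _)).
Qed.

Section FusionCategories.
Context (k : closedFieldType) (C : fusion_cat k) (M : bimodcat C).
Context (F : bimodfunctor (regular_bimod C) M).

Lemma fusion_kernels : has_kernels C.
Proof. exact: ab_kernel (fin_abelian (tcat_finite C)). Qed.

Lemma unit_brick (D : tensor_cat k) : brick (munit : D).
Proof.
have [g gK Kg] := tcat_one D; split=> [|f]; last by exists (g f); rewrite Kg.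
apply: contraNneq (oner_neq0 k) => e; apply/eqP.
by rewrite -[1]gK -[0]gK /= scale1r scale0r e.
Qed.

Lemma iso_brick (A : lincat k) (X Y : A) (i : iso X Y) : brick X -> brick Y.
Proof.
move=> [nz scal]; split=> [|f].
  apply: contra_neq nz => e.
  by rewrite -(fwdK i) -[fwd i]comp1m e comp0m compm0.
have [c ec] := scal (bwd i ∘ f ∘ fwd i); exists c.
apply: (iso_bwd_inj (i := i)); apply: (fwd_iso_inj (i := i)).
by rewrite ec compZr compm1 compZl fwdK.
Qed.

Hypothesis kerM : has_kernels M.
Hypothesis ssM : semisimple M.
Hypothesis brickF1 : brick (F munit).

Lemma scalar_ofK (f : hom (munit : C) munit) : f = scalar_of f *: idm munit.
Proof. exact: brick_coefK (unit_brick C). Qed.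

Lemma separable_frobenius : separable C -> exists R : bimodfunctor M (regular_bimod C),
  inhabited (bimod_adjunction R F) /\ inhabited (bimod_adjunction F R).
Proof.
move=> [D [n [S [c [[simS repS distS] sqS ->]]]] dim_neq0].
have kerC := fusion_kernels; have ssC := @fcat_semisimple k C.
have brick1 := unit_brick C; have rigC := tcat_rigid C.
have genS : generating S by apply: semisimple_generating.
have brickS i : brick (S i) by apply: (simple_brick kerC).
have orthS i j (f : hom (S i) (S j)) : i != j -> f = 0.
  move=> nij; apply/eqP/negP => /negP /(schur kerC (simS i) (simS j))[g [gf fg]].
  by case/eqP: nij; apply: distS; constructor; exists f g.
have a i : {a : iso (S i) (dualobj (dualobj (S i))) |
    c i = trace (fwd a) * trace (dualm (bwd a))}.
  exact/constructive_indefinite_description/sqS.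
pose d i := ldualP (tcat_rigid C) (S i).
pose d' i := double_dual (ldualP (tcat_rigid C) (dualobj (S i))) (sval (a i)).
(* The two circles are the two traces whose product is the squared norm [c i], so the normalizing
   constant of the average is the global dimension. *)
have rE i : ev (d' i) ∘ coev (d i) = trace (fwd (sval (a i))) *: idm munit.
  exact: scalar_ofK.
have wE i : ev (d i) ∘ coev (d' i) = trace (dualm (bwd (sval (a i)))) *: idm munit.
  by rewrite -scalar_ofK ev_dualm -compA.
have [E] : inhabited (expectation F).
  apply: (expectation_exists kerC ssC rigC brick1 brickF1 genS brickS orthS rE wE).
  by rewrite -(eq_bigr _ (fun i _ => proj2_sig (a i))).
have ex m : {x : {r & hom (F r) m} | universal_arrow (F := F) (tagged x)}.
  apply: constructive_indefinite_description.
  have [r [e univ]] := universal_arrow_exists F (fin_abelian (tcat_finite C)) genS brickS orthS m.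
  by exists (existT _ r e).
have univ m : universal_arrow (F := F) (tagged (sval (ex m))) := proj2_sig (ex m).
have adj := left_adjunction kerC ssC kerM ssM rigC brick1 brickF1 E univ.
exists (Rbimod rigC univ); split; constructor; [exact: adj | exact: right_adjunction].
Qed.

End FusionCategories.

Theorem theorem3p24 (k : closedFieldType) (C D : fusion_cat k)
    (F : tensor_functor C D) :
  separable C -> separable D -> tensor_frobenius F.
Proof.
move=> sepC _; have brickF1 : brick (tensor_bimodfunctor F munit).
  exact: iso_brick (mone F) (unit_brick D).
have [R [LR RL]] := separable_frobenius (@fusion_kernels k D : has_kernels (target_bimod F))
  (@fcat_semisimple k D) brickF1 sepC.
exists R, R; split=> //.
have t : {t : bimodtrans R R | forall m, t m = idm (R m)}.
  unshelve refine (exist _ (@BimodTrans _ _ _ _ R R (fun m => idm (R m)) _ _ _) _).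
  - by move=> m m' h; rewrite comp1m compm1.
  - by move=> X m; rewrite comp1m bmap1 compm1.
  - by move=> m X; rewrite comp1m bmap1 compm1.
  by [].
exists (sval t) => m; rewrite (proj2_sig t).
by exists (idm (R m)); rewrite comp1m.
Qed.
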